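(* Let $s>0$ and suppose $f,h\in L^2(\mathbb{R}^n)$ are even and $s$-concave on their supports. Then the following inequalities hold: for $0<\alpha<n$, $$\frac{\left(nB\left(n,n+1+\frac2s\right)\right)^{\frac{\alpha}{n}}}{B\left(\alpha,n+1+\frac2s\right)}\,|S_\alpha(f,h)|^{\frac{\alpha}{n}}\ \ge\ \left(\|f\|_1\|h\|_1\right)^{\frac{\alpha}{n}}\left(\int_{\mathbb{R}^n}f(x)h(x)\,dx\right)^{1-\frac{\alpha}{n}}\ \ge\ \left\|f^{\frac{n+\alpha}{2n}}h^{\frac{n-\alpha}{2n}}\right\|_{\frac{2n}{n+\alpha}}\left\|h^{\frac{n+\alpha}{2n}}f^{\frac{n-\alpha}{2n}}\right\|_{\frac{2n}{n+\alpha}},$$ and for $\alpha>n$, $$\frac{\left(nB\left(n,n+1+\frac2s\right)\right)^{\frac{\alpha}{n}}}{B\left(\alpha,n+1+\frac2s\right)}\,|S_\alpha(f,h)|^{\frac{\alpha}{n}}\ \le\ \left(\|f\|_1\|h\|_1\right)^{\frac{\alpha}{n}}\left(\int_{\mathbb{R}^n}f(x)h(x)\,dx\right)^{1-\frac{\alpha}{n}}\ \le\ \left\|f^{\frac{n+\alpha}{2n}}h^{\frac{n-\alpha}{2n}}\right\|_{\frac{2n}{n+\alpha}}\left\|h^{\frac{n+\alpha}{2n}}f^{\frac{n-\alpha}{2n}}\right\|_{\frac{2n}{n+\alpha}}.$$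
   Context: $B(\cdot,\cdot)$ is the Beta function. For $s>0$, a function $f:\mathbb{R}^n\to[0,\infty)$ is $s$-concave on its support if $\{f>0\}$ is convex and $f((1-\lambda)x+\lambda y)^s\ge(1-\lambda)f(x)^s+\lambda f(y)^s$ for all $x,y\in\{f>0\}$ and $0\le\lambda\le1$. $\|f\|_q=(\int_{\mathbb{R}^n}|f|^q)^{1/q}$ for $q>0$ (also $q<1$). $|E|$ is $n$-dimensional Lebesgue measure. For non-negative measurable $f,h$ and $\alpha>0$, $S_\alpha(f,h)$ is the star-shaped set (with respect to the origin) with radial function given by $$\rho_{S_\alpha(f,h)}(\xi)^\alpha=\int_0^\infty t^{\alpha-1}\int_{\mathbb{R}^n}h(x)f(x+t\xi)\,dx\,dt,\qquad \xi\in\mathbb{R}^n\setminus\{0\},$$ where $\rho_K(x)=\sup\{\lambda\ge0:\lambda x\in K\}$; so $|S_\alpha(f,h)|=\frac1n\int_{\mathbb{S}^{n-1}}\rho_{S_\alpha(f,h)}(\xi)^n\,d\xi$, with $d\xi$ the $(n-1)$-dimensional Hausdorff measure. *)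

(* Defs.v *)
From HB Require Import structures.
From mathcomp Require Import all_boot all_order all_algebra.
From mathcomp Require Import all_classical all_reals all_analysis.
From mathcomp Require Import measurable_realfun.

Set Implicit Arguments.
Unset Strict Implicit.
Unset Printing Implicit Defensive.

Import Order.TTheory GRing.Theory Num.Theory.
Import numFieldNormedType.Exports.

Local Open Scope classical_set_scope.
Local Open Scope ring_scope.

Definition measure_rV_display : measure_display -> measure_display.
Proof. exact. Qed.

(* 'rV[T]_n carries the sigma-algebra generated by the coordinate maps, as
   n.-tuple T does in the library; for T a realType it is the Borel one. *)
Section measurable_rV.
Context {d} {T : measurableType d} {n : nat}.

Let coord (i : 'I_n) (v : 'rV[T]_n) : T := v ord0 i.

Let rV_set0 : g_sigma_preimage coord set0.
Proof. exact: sigma_algebra0. Qed.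

Let rV_setC A : g_sigma_preimage coord A -> g_sigma_preimage coord (~` A).
Proof. exact: sigma_algebraC. Qed.

Let rV_bigcup (F : (set 'rV[T]_n)^nat) :
  (forall i, g_sigma_preimage coord (F i)) ->
  g_sigma_preimage coord (\bigcup_i (F i)).
Proof. exact: sigma_algebra_bigcup. Qed.

HB.instance Definition _ := @isMeasurable.Build (measure_rV_display d)
  'rV[T]_n (g_sigma_preimage coord) rV_set0 rV_setC rV_bigcup.

End measurable_rV.

Section measurable_fun_rV.
Context d1 d2 (T1 : measurableType d1) (T2 : measurableType d2).

Lemma measurable_coord n (i : 'I_n) :
  measurable_fun [set: 'rV[T2]_n] (fun v : 'rV[T2]_n => v ord0 i).
Proof.
move=> _ Y mY; rewrite setTI; apply: sub_sigma_algebra => /=.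
rewrite -bigcup_seq/=; exists i => /=; first by rewrite mem_index_enum.
by exists Y => //; rewrite setTI.
Qed.

Lemma measurable_fun_rV n (f : T1 -> 'rV[T2]_n) :
  (forall i, measurable_fun [set: T1] (fun x => f x ord0 i)) ->
  measurable_fun [set: T1] f.
Proof.
move=> mf _ Y mY; rewrite setTI.
have : g_sigma_preimage (fun (i : 'I_n) (v : 'rV[T2]_n) => v ord0 i) Y by [].
pose P := [set A : set 'rV[T2]_n | measurable (f @^-1` A)].
apply: (_ : _ `<=` P); apply: smallest_sub.
  split => /=.
  - by rewrite /P/= preimage_set0.
  - by move=> A PA; rewrite /P/= setTD preimage_setC; exact: measurableC.
  - move=> F PF; rewrite /P/= preimage_bigcup.
    by apply: bigcup_measurable => k _; exact: PF.
rewrite -bigcup_seq => A [i _ [B mB <-]]; rewrite /P/= setTI.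
by have := mf i measurableT _ mB; rewrite setTI.
Qed.

End measurable_fun_rV.

(* The library's instance for m1 \x m2 is shadowed by the subprobability one. *)
Lemma product_measure_sigma_finite d1 d2 (T1 : measurableType d1)
    (T2 : measurableType d2) (R : realType)
    (m1 : {sigma_finite_measure set T1 -> \bar R})
    (m2 : {sigma_finite_measure set T2 -> \bar R}) :
  sigma_finite [set: T1 * T2] (m1 \x m2)%E.
Proof.
have /sigma_finiteP[F [TF ndF Foo]] := sigma_finiteT m1.
have /sigma_finiteP[G [TG ndG Goo]] := sigma_finiteT m2.
exists (fun n => F n `*` G n).
  rewrite -setXTT TF TG predeqE => -[x y]; split.
    move=> [/= [n _ Fnx] [k _ Gky]]; exists (maxn n k) => //; split.
    - by move: x Fnx; exact/subsetPset/ndF/leq_maxl.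
    - by move: y Gky; exact/subsetPset/ndG/leq_maxr.
  by move=> [n _ []/= ? ?]; split; exists n.
move=> k; have [? ?] := Foo k; have [? ?] := Goo k.
split; first exact: measurableX.
by rewrite product_measure1E// lte_mul_pinfty// ge0_fin_numE.
Qed.

Section lebesgue_rV.
Context {R : realType}.

Definition consV n (p : measurableTypeR R * 'rV[R]_n) :
    'rV[R]_n.+1 :=
  \row_i (if unlift ord0 i is Some j then p.2 ord0 j else p.1).

Lemma measurable_consV n : measurable_fun [set: measurableTypeR R * 'rV[R]_n] (@consV n).
Proof.
apply: measurable_fun_rV => i; rewrite /consV.
case: (unliftP ord0 i) => [j ij|i0].
  rewrite (_ : (fun _ => _) = (fun v : 'rV[R]_n => v ord0 j) \o snd).
    by apply: measurableT_comp; [exact: measurable_coord|exact: measurable_snd].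
  by apply/funext => p /=; rewrite mxE ij liftK.
rewrite (_ : (fun _ => _) = fst); first exact: measurable_fst.
by apply/funext => p /=; rewrite mxE i0 unlift_none.
Qed.

Section step.
Variables (n : nat) (mu : {sigma_finite_measure set 'rV[R]_n -> \bar R}).

Definition lebesgue_cons : set 'rV[R]_n.+1 -> \bar R :=
  pushforward (lebesgue_measure \x mu)%E (@consV n).

Let lebesgue_cons0 : (lebesgue_cons set0 = 0)%E.
Proof. by rewrite /lebesgue_cons /pushforward preimage_set0 measure0. Qed.

Let lebesgue_cons_ge0 A : (0 <= lebesgue_cons A)%E.
Proof. by rewrite /lebesgue_cons /pushforward; exact: measure_ge0. Qed.

Let mpreimage_consV (A : set 'rV[R]_n.+1) :
  measurable A -> measurable (@consV n @^-1` A).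
Proof.
by move=> mA; rewrite -[X in measurable X]setTI; exact: measurable_consV.
Qed.

Let lebesgue_cons_sigma_additive : semi_sigma_additive lebesgue_cons.
Proof.
move=> F mF tF mUF; rewrite /lebesgue_cons /pushforward preimage_bigcup.
apply: measure_semi_sigma_additive.
- by move=> k; exact: mpreimage_consV.
- apply/trivIsetP => /= i j _ _ ij; rewrite -preimage_setI.
  by move/trivIsetP : tF => /(_ _ _ _ _ ij) ->//; rewrite preimage_set0.
- by rewrite -preimage_bigcup; exact: mpreimage_consV.
Qed.

HB.instance Definition _ := isMeasure.Build _ _ _ lebesgue_cons
  lebesgue_cons0 lebesgue_cons_ge0 lebesgue_cons_sigma_additive.

Let unconsV (v : 'rV[R]_n.+1) : measurableTypeR R * 'rV[R]_n :=
  (v ord0 ord0, \row_j v ord0 (lift ord0 j)).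

Let consVK : cancel (@consV n) unconsV.
Proof.
case=> x v; rewrite /unconsV /consV/= mxE unlift_none; congr pair.
by apply/rowP => j; rewrite !mxE liftK.
Qed.

Let measurable_unconsV : measurable_fun [set: 'rV[R]_n.+1] unconsV.
Proof.
apply/measurable_fun_pairP; split; first exact: measurable_coord.
apply: measurable_fun_rV => j.
rewrite (_ : (fun _ => _) = (fun v : 'rV[R]_n.+1 => v ord0 (lift ord0 j))).
  exact: measurable_coord.
by apply/funext => v /=; rewrite mxE.
Qed.

Let lebesgue_cons_sigma_finite : sigma_finite [set: 'rV[R]_n.+1] lebesgue_cons.
Proof.
have [F FT mF] : sigma_finite [set: measurableTypeR R * 'rV[R]_n]
    (lebesgue_measure \x mu)%E.
  exact: (product_measure_sigma_finite lebesgue_measure mu).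
exists (fun k => unconsV @^-1` F k).
  by rewrite -preimage_bigcup -FT preimage_setT.
move=> k; have [mFk Fk] := mF k; split.
  by rewrite -[X in measurable X]setTI; exact: measurable_unconsV.
rewrite /lebesgue_cons /pushforward -comp_preimage.
by rewrite (_ : unconsV \o _ = id)//; apply/funext => p /=; exact: consVK.
Qed.

HB.instance Definition _ := Measure_isSigmaFinite.Build _ _ _ lebesgue_cons
  lebesgue_cons_sigma_finite.

End step.

Fixpoint lebesgue_rV n : {sigma_finite_measure set 'rV[R]_n -> \bar R} :=
  if n is m.+1 return {sigma_finite_measure set 'rV[R]_n -> \bar R}
  then lebesgue_cons (lebesgue_rV m) else \d_(0 : 'rV[R]_0).

End lebesgue_rV.

Section lebesgue_rV_box.
Context {R : realType}.

Lemma measurable_rV_box n (A : 'I_n -> set R) :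
  (forall i, measurable (A i)) ->
  measurable [set v : 'rV[R]_n | forall i, A i (v ord0 i)].
Proof.
move=> mA.
rewrite (_ : [set _ | _] =
    \bigcap_(i in [set: 'I_n]) (fun v : 'rV[R]_n => v ord0 i) @^-1` A i).
  apply: fin_bigcap_measurable => // i _.
  by have := @measurable_coord _ R n i measurableT _ (mA i); rewrite setTI.
by apply/seteqP; split => [v Av i _|v Av i]; exact: Av.
Qed.

(* This property characterizes n-dimensional Lebesgue measure. *)
Lemma lebesgue_rV_box n (A : 'I_n -> set R) :
  (forall i, measurable (A i)) ->
  (lebesgue_rV n [set v | forall i, A i (v ord0 i)] =
   \prod_(i < n) lebesgue_measure (A i))%E.
Proof.
elim: n A => [|n IH] A mA.
  rewrite big_ord0 /= diracE mem_set//.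
  by case.
rewrite big_ord_recl -(IH (fun i => A (lift ord0 i)))//.
rewrite -product_measure1E; [|exact: mA|exact: (@measurable_rV_box n (fun i => A (lift ord0 i)))].
rewrite /= /lebesgue_cons /pushforward; congr (_ _).
apply/seteqP; split => [[x v] Av|[x v] [/= Ax Av] i].
  split=> [|i] /=.
    by have := Av ord0; rewrite /consV mxE unlift_none.
  by have := Av (lift ord0 i); rewrite /consV mxE liftK.
rewrite /consV mxE; case: (unliftP ord0 i) => [j ->|->]; last exact: Ax.
exact: Av.
Qed.

End lebesgue_rV_box.

Section statement_notions.
Context {R : realType}.
Local Open Scope ereal_scope.

Definition beta (a b : R) : R :=
  (\int[@lebesgue_measure R]_(t in `[0%R, 1%R])
     (t `^ (a - 1) * (1 - t) `^ (b - 1)))%R.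

(* Real powers on [0, +oo] with the usual values 0 ^ p = +oo and
   (+oo) ^ p = 0 for p < 0; the library's poweR has 0 `^ p = 0 there. *)
Definition powere (x : \bar R) (p : R) : \bar R :=
  if (p < 0)%R then (x `^ (- p))^-1 else x `^ p.

Variable n : nat.
Implicit Types (f h : 'rV[R]_n -> R) (K : set 'rV[R]_n).

Definition even_fun f := forall x, f (- x)%R = f x.

Definition s_concave_on_support (s : R) f :=
  convex_set ([set x | (0 < f x)%R] : set (convex_lmodType 'rV[R]_n)) /\
  forall x y (l : R), (0 < f x)%R -> (0 < f y)%R -> (0 <= l <= 1)%R ->
    ((1 - l) * f x `^ s + l * f y `^ s <= f ((1 - l) *: x + l *: y) `^ s)%R.

(* Measurability is in the Lebesgue sense: f is only required to agree almost
   everywhere with a Borel function of finite L^2 norm. *)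
Definition square_integrable f :=
  exists2 g : 'rV[R]_n -> R,
    g \in Lfun (lebesgue_rV n) 2%:E & {ae lebesgue_rV n, forall x, f x = g x}.

Definition radial K (x : 'rV[R]_n) : \bar R :=
  ereal_sup [set l%:E | l in [set l : R | (0 <= l)%R /\ K (l *: x)%R]].

Definition radial_moment (alpha : R) f h (xi : 'rV[R]_n) : \bar R :=
  \int[@lebesgue_measure R]_(t in `]0%R, +oo[)
    ((t `^ (alpha - 1))%:E *
     \int[lebesgue_rV n]_x (h x * f (x + t *: xi))%:E).

(* The star-shaped set {xi = 0 or 1 <= rho(xi)} whose radial function rho is
   given by rho(xi)^alpha = radial_moment alpha f h xi; radial_star_moment below
   checks that rho is indeed its radial function. *)
Definition star_moment (alpha : R) f h : set 'rV[R]_n :=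
  [set xi | xi = 0%R \/ 1 <= radial_moment alpha f h xi].

End statement_notions.

Section scaling.
Context {R : realType}.
Local Open Scope ereal_scope.
Local Notation leb := (@lebesgue_measure R).

Lemma ge0_le_integral_gen d (T : measurableType d)
    (mu : {measure set T -> \bar R}) (F G : T -> \bar R) :
  (forall x, 0 <= F x) -> (forall x, F x <= G x) ->
  \int[mu]_x F x <= \int[mu]_x G x.
Proof.
move=> F0 FG.
have G0 x : 0 <= G x by rewrite (le_trans (F0 x)).
rewrite !ge0_integralTE//; apply: ereal_sup_le => _ [u /= uF <-].
by exists u => //= x; rewrite (le_trans (uF x)).
Qed.

Lemma lebesgue_measure_scale (c : R) (A : set (measurableTypeR R)) :
  (0 < c)%R -> measurable A ->
  leb ((fun t => c * t)%R @^-1` A) = c^-1%:E * leb A.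
Proof.
move=> c0 mA.
pose phi (t : measurableTypeR R) : measurableTypeR R := (c * t)%R.
have mphi : measurable_fun setT phi by apply: measurable_funM.
pose k : {nonneg R} := NngNum (ltW c0).
pose nu' : {measure set (measurableTypeR R) -> \bar R} :=
  mscale k (pushforward leb phi).
pose nu := nu' mphi.
have nuE X : nu X = c%:E * leb (phi @^-1` X) by [].
have -> : leb A = nu A.
  apply: lebesgue_measure_unique => // _ [[a b]] _ <-.
  rewrite nuE (_ : phi @^-1` _ = `](c^-1 * a)%R, (c^-1 * b)%R]%classic); last first.
    apply/seteqP; split => t /=; rewrite !in_itv/= /phi.
      by rewrite ltr_pdivrMl// ler_pdivlMl.
    by rewrite ltr_pdivrMl// ler_pdivlMl.
  rewrite !lebesgue_measure_itv/= !lte_fin ltr_pM2l ?invr_gt0//.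
  case: ifPn => _; last by rewrite mule0.
  by rewrite -!EFinD -EFinM mulrBr !mulVKf ?gt_eqF.
by rewrite nuE muleA -EFinM mulVf ?gt_eqF// mul1e.
Qed.

Import HBNNSimple.

Let scale_le (c k : R) (F : R -> \bar R) : (0 < c)%R -> (0 < k)%R ->
  (forall t, 0 <= F t) ->
  (k / c)%:E * \int[leb]_t F t <= \int[leb]_t (k%:E * F (c * t)%R).
Proof.
move=> c0 k0 F0.
rewrite -lee_pdivlMl ?divr_gt0// (@ge0_integralTE _ _ _ leb _ F0).
apply: ge_ereal_sup => _ [u /= uF <-].
rewrite lee_pdivlMl ?divr_gt0// -integralT_nnsfun.
have u0 t : 0 <= (u t)%:E by rewrite lee_fin; exact: fun_ge0.
have -> : (k / c)%:E * \int[leb]_t (u t)%:E =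
          \int[leb]_t (k%:E * (u (c * t)%R)%:E).
  pose phi (t : measurableTypeR R) : measurableTypeR R := (c * t)%R.
  have mphi : measurable_fun setT phi by apply: measurable_funM.
  have mu : measurable_fun setT (fun t : measurableTypeR R => (u t)%:E).
    exact/measurable_EFinP.
  rewrite ge0_integralZl//; last 2 first.
  - by apply: (measurableT_comp mu mphi).
  - by rewrite lee_fin ltW.
  rewrite -[X in _ = _ * X](ge0_integral_pushforward mphi leb measurableT mu)//.
  have ci0 : (0 <= c^-1)%R by rewrite invr_ge0 ltW.
  pose ci : {nonneg R} := NngNum ci0.
  rewrite [X in _ = _ * X](eq_measure_integral (mscale ci leb)); last first.
    by move=> A mA _; exact: lebesgue_measure_scale.
  by rewrite ge0_integral_mscale//= muleA -EFinM.
apply: ge0_le_integral_gen => t.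
  by rewrite mule_ge0 ?u0// lee_fin ltW.
by rewrite lee_wpmul2l// lee_fin ltW.
Qed.

Lemma integral_scale (c k : R) (F : R -> \bar R) : (0 < c)%R -> (0 < k)%R ->
  (forall t, 0 <= F t) ->
  \int[leb]_t (k%:E * F (c * t)%R) = (k / c)%:E * \int[leb]_t F t.
Proof.
move=> c0 k0 F0; apply/eqP; rewrite eq_le scale_le// andbT.
pose G t := k%:E * F (c * t)%R.
have G0 t : 0 <= G t by rewrite mule_ge0// lee_fin ltW.
have ci0 : (0 < c^-1)%R by rewrite invr_gt0.
have ki0 : (0 < k^-1)%R by rewrite invr_gt0.
have := scale_le ci0 ki0 G0.
have -> : \int[leb]_t (k^-1%:E * G (c^-1 * t)%R) = \int[leb]_t F t.
  apply: eq_integral => t _; rewrite /G muleA -EFinM mulVf ?gt_eqF// mul1e.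
  by rewrite mulVKf ?gt_eqF.
by rewrite invrK -lee_pdivlMl ?mulr_gt0// invfM invrK.
Qed.

End scaling.

Section radial_star_moment.
Context {R : realType} {n : nat}.
Local Open Scope ereal_scope.
Local Notation leb := (@lebesgue_measure R).
Variables (alpha : R) (f h : 'rV[R]_n -> R).
Hypotheses (alpha_gt0 : (0 < alpha)%R).
Hypotheses (f_ge0 : forall x, (0 <= f x)%R) (h_ge0 : forall x, (0 <= h x)%R).

Let inner_ge0 (y : 'rV[R]_n) :
  0 <= \int[lebesgue_rV n]_x (h x * f (x + y)%R)%:E.
Proof. by apply: integral_ge0 => x _; rewrite lee_fin mulr_ge0. Qed.

Lemma radial_moment_ge0 xi : 0 <= radial_moment alpha f h xi.
Proof.
apply: integral_ge0 => t _.
by rewrite mule_ge0// lee_fin powR_ge0.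
Qed.

Lemma radial_moment_scale (c : R) xi : (0 < c)%R ->
  radial_moment alpha f h (c *: xi) =
  (c `^ (- alpha))%:E * radial_moment alpha f h xi.
Proof.
move=> c0; rewrite /radial_moment [LHS]integral_mkcond [in RHS]integral_mkcond.
pose F (t : R) := (t `^ (alpha - 1))%:E *
  \int[lebesgue_rV n]_x (h x * f (x + t *: xi)%R)%:E.
pose F0 : R -> \bar R := F \_ `]0%R, +oo[.
have F0_ge0 t : 0 <= F0 t.
  by apply: erestrict_ge0 => u _; rewrite mule_ge0// lee_fin powR_ge0.
pose k : R := (c `^ (1 - alpha))%R.
have k0 : (0 < k)%R by rewrite powR_gt0.
have -> : (c `^ (- alpha) = k / c)%R.
  rewrite /k powRD ?(gt_eqF c0) ?implybT// powRr1 ?ltW//.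
  by rewrite mulrAC mulfV ?(gt_eqF c0)// mul1r.
rewrite -[RHS](integral_scale c0 k0 F0_ge0); apply: eq_integral => t _.
rewrite /F0 !patchE !mem_setE !in_itv/= !andbT pmulr_rgt0//.
case: ifPn => [t0|_]; last by rewrite mule0.
rewrite /F muleA -EFinM scalerA [(t * c)%R]mulrC. congr (_%:E * _).
rewrite powRM ?ltW// mulrA /k -powRD ?(gt_eqF c0) ?implybT//.
by rewrite -[(1 - alpha)%R]opprB addNr powRr0 mul1r.
Qed.

Lemma radial_star_moment xi : xi != 0%R ->
  radial (star_moment alpha f h) xi `^ alpha = radial_moment alpha f h xi.
Proof.
move=> xi0; set I := radial_moment alpha f h xi.
have I0 : 0 <= I by exact: radial_moment_ge0.
have starE (l : R) : (0 <= l)%R ->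
    star_moment alpha f h (l *: xi)%R <-> (l `^ alpha)%:E <= I.
  rewrite le_eqVlt => /predU1P[<-|l0].
    rewrite powR0 ?gt_eqF// scale0r; split => // _; exact: or_introl.
  have -> : star_moment alpha f h (l *: xi)%R <->
      1 <= radial_moment alpha f h (l *: xi)%R.
    split=> [[lxi0|lxi1]|lxi1]; [|exact: lxi1|right; exact: lxi1].
    exfalso; move/negP: xi0; apply; apply/eqP.
    move: lxi0 => /(congr1 (fun v => l^-1 *: v)%R).
    by rewrite scaler0 scalerA mulVf ?(gt_eqF l0)// scale1r.
  by rewrite radial_moment_scale// powRN lee_pdivlMl ?powR_gt0// mule1.
suff -> : radial (star_moment alpha f h) xi = I `^ alpha^-1.
  by rewrite -poweRrM mulVf ?gt_eqF// poweRe1.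
rewrite /radial; apply/eqP; rewrite eq_le; apply/andP; split.
  apply: ge_ereal_sup => _ [l [l0 /(starE _ l0) lI] <-].
  have -> : l%:E = (l `^ alpha)%:E `^ alpha^-1.
    by rewrite poweR_EFin -powRrM mulfV ?gt_eqF// powRr1.
  apply: gt0_ler_poweR; rewrite ?in_itv/= ?leey ?andbT//.
  - by rewrite invr_ge0 ltW.
  - by rewrite lee_fin powR_ge0.
case: I I0 starE => [r| |//] I0 starE.
  apply: ereal_sup_ubound; exists (r `^ alpha^-1)%R => //; split.
    exact: powR_ge0.
  apply/starE; first exact: powR_ge0.
  by rewrite -powRrM mulVf ?gt_eqF// powRr1.
rewrite poweRyr ?invr_neq0 ?gt_eqF//.
rewrite leye_eq; apply/eqP/eq_infty => r.
apply: le_ereal_sup_tmp; exists (Num.max 0 r)%:E.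
  exists (Num.max 0 r)%R => //; split; first by rewrite le_max lexx.
  by apply/starE; rewrite ?le_max ?lexx ?leey.
by rewrite lee_fin le_max lexx orbT.
Qed.

End radial_star_moment.

(* Main.v *)
Require Import Defs.
From HB Require Import structures.
From mathcomp Require Import all_boot all_order all_algebra.
From mathcomp Require Import all_classical all_reals all_analysis.
From mathcomp Require Import measurable_realfun.
From mathcomp Require Import ring lra.
Set Implicit Arguments.
Unset Strict Implicit.
Unset Printing Implicit Defensive.
Import Order.TTheory GRing.Theory Num.Theory.
Import numFieldNormedType.Exports.
Local Open Scope classical_set_scope.
Local Open Scope ring_scope.

(** Write [g y] for the integral of [h x * f (x + y)] over [x] and [G = g 0] for
    the integral of [f h]. By Tonelli the integral of [g] is the product of the
    integrals of [f] and [h], and the [alpha]-th radial moment of the star body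
    in the direction [xi] is the integral of [t ^ (alpha - 1) * g (t xi)] over
    [t > 0].

    The first inequality rests on the concavity of [g]. The function
    [h x * f (x + y)] is [s / 2]-concave in [(x, y)], so by the
    Borell-Brascamp-Lieb inequality [bbl_rV] its marginal [g] is [1 / k]-concave
    for [k = n + 2 / s] ([corr_concave]). As [g] is even, it is at most [G].
    On a ray, [g] is then compared with the extremal profile
    [G (1 - t / r)_+ ^ k], whose [a]-th moment is [G r ^ a B(a, k + 1)]: Berwald's
    inequality ([berwald_level]) says that for [a < b] a ray whose [b]-th moment
    reaches that of the profile also has an [a]-th moment that reaches it. Taking
    [r] such that the [alpha]-th moment of the profile is [1], and calling [K]
    its [n]-th moment, the star body, which is the set where the [alpha]-th
    moment is at least [1], contains the set where the [n]-th moment is at least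
    [K] when [alpha < n]. It is contained in it, up to the origin, when
    [n < alpha]. The volume of
    that set is the integral of [g] divided by [n K]
    ([volume_superlevel]). This is integration in polar coordinates, done
    without a sphere: only Tonelli's theorem and dilations are used. Inserting
    the value of [K] gives the first inequality.

    The second inequality is Hölder's inequality for the two mixed norms, applied
    to [f h ^ r = f ^ (1 - r) (f h) ^ r] with [r = (n - alpha) / (n + alpha)] when
    [alpha < n] ([mixed_integral_le]), and to
    [f = (f h ^ r) ^ a (f h) ^ (1 - a)] with [a = (n + alpha) / (2 alpha)], where
    [r] is negative, when [n < alpha] ([mixed_integral_ge]).

    The functions [f] and [h] only agree almost everywhere with Borel functions,
    while concavity holds everywhere for [f] and [h] themselves. Both can be used at
    once because each function lies between two Borel functions that agree
    almost everywhere ([square_integrable_squeeze]), and the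
    Borell-Brascamp-Lieb inequality only needs minorants on one side and a
    majorant on the other. The integrals in the statement do not see null sets,
    even for functions that are not Borel ([ae_eq_integral_gen]). *)

(** * Lower integrals *)

Section ae_integral.
Context d (T : measurableType d) (R : realType).
Variable mu : {measure set T -> \bar R}.
Local Open Scope ereal_scope.

Import HBNNSimple.

(** The integral of a nonnegative function is the supremum over the simple
    functions below it, and these may be cut off on a null set at no cost; hence
    no measurability is needed. *)
Lemma ae_le_integral_gen (F G : T -> \bar R) :
  (forall x, 0 <= F x) -> (forall x, 0 <= G x) ->
  {ae mu, forall x, F x <= G x} -> \int[mu]_x F x <= \int[mu]_x G x.
Proof.
move=> F0 G0 [N [mN N0 FG]].
rewrite (@ge0_integralTE _ _ _ mu _ F0); apply: ge_ereal_sup => _ [u /= uF <-].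
rewrite -integralT_nnsfun (ge0_negligible_integral mN)//; last 2 first.
- exact/measurable_EFinP.
- by move=> x _; rewrite lee_fin.
rewrite integral_mkcond; apply: ge0_le_integral_gen => x; rewrite patchE.
  by case: ifPn => // _; rewrite lee_fin.
case: ifPn => // /set_mem[_ Nx]; apply: le_trans (uF x) _.
by apply: contrapT => FGx; apply: Nx; exact: FG.
Qed.

Lemma ae_eq_integral_gen (F G : T -> \bar R) :
  (forall x, 0 <= F x) -> (forall x, 0 <= G x) ->
  {ae mu, forall x, F x = G x} -> \int[mu]_x F x = \int[mu]_x G x.
Proof.
move=> F0 G0 FG; apply/eqP; rewrite eq_le; apply/andP; split;
  apply: ae_le_integral_gen => //; apply: filterS FG => x ->; exact: lexx.
Qed.

End ae_integral.

(** * Lebesgue measure under affine maps *)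

Section lebesgue_affine.
Context {R : realType}.
Local Open Scope ereal_scope.
Local Notation leb := (@lebesgue_measure R).

Lemma lebesgue_measure_shift (b : R) (A : set (measurableTypeR R)) :
  measurable A -> leb ((fun t => t + b)%R @^-1` A) = leb A.
Proof.
move=> mA.
pose phi (t : measurableTypeR R) : measurableTypeR R := (t + b)%R.
have mphi : measurable_fun setT phi by apply: measurable_funD.
pose nu' : {measure set (measurableTypeR R) -> \bar R} := pushforward leb phi.
rewrite -[LHS]/(nu' mphi A); apply/esym/lebesgue_measure_unique => // _ [[x y]] _ <-.
rewrite /nu' /= /pushforward.
rewrite (_ : phi @^-1` _ = `](x - b)%R, (y - b)%R]%classic); last first.
  by apply/seteqP; split => t /=; rewrite !in_itv/= /phi ltrBlDr lerBrDr.
rewrite !lebesgue_measure_itv/= !lte_fin ltrBlDr subrK.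
by case: ifPn => // _; rewrite -!EFinB; congr (_%:E); ring.
Qed.

Lemma integral_affine (c b : R) (F : R -> \bar R) : c != 0%R ->
  measurable_fun [set: R] F -> (forall t, 0 <= F t) ->
  \int[leb]_t F (c * t + b)%R = `|c|^-1%:E * \int[leb]_t F t.
Proof.
move=> c0 mF F0.
pose phi (t : measurableTypeR R) : measurableTypeR R := (c * t + b)%R.
have mphi : measurable_fun setT phi.
  by apply: measurable_funD => //; apply: measurable_funM.
have ci0 : (0 <= `|c|^-1)%R by rewrite invr_ge0.
rewrite -[LHS](ge0_integral_pushforward mphi leb measurableT mF)//.
rewrite (eq_measure_integral (mscale (NngNum ci0) leb)); last first.
  move=> A mA _; rewrite [RHS]/(_%:E * leb A) [LHS]/(leb _) /=.
  have -> : phi @^-1` A = (fun t => c * t)%R @^-1` ((fun t => t + b)%R @^-1` A) by [].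
  have mbA : measurable ((fun t : measurableTypeR R => t + b)%R @^-1` A).
    rewrite -[X in measurable X]setTI.
    by apply: (measurable_funD (f := id) (g := cst b)) => //.
  rewrite -(lebesgue_measure_shift b mA).
  have [c_gt0|c_lt0|/esym/eqP] := ltgtP 0%R c; last by rewrite (negbTE c0).
    by rewrite gtr0_norm//; exact: lebesgue_measure_scale.
  have cN0 : (0 < - c)%R by rewrite oppr_gt0.
  rewrite ltr0_norm//.
  rewrite -[RHS](lebesgue_measure_scale cN0 mbA) -lebesgue_measureN; last first.
    by rewrite -[X in measurable X]setTI; exact: measurable_funM.
  by congr (leb _); apply/seteqP; split => t /=; rewrite mulrNN.
by rewrite ge0_integral_mscale.
Qed.

Lemma integral_rVS n (F : 'rV[R]_n.+1 -> \bar R) :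
  measurable_fun setT F -> (forall x, 0 <= F x) ->
  \int[lebesgue_rV n.+1]_x F x =
  \int[leb]_t \int[lebesgue_rV n]_v F (consV (t, v)).
Proof.
move=> mF F0.
rewrite -[LHS]/(\int[pushforward (leb \x lebesgue_rV n) (@consV R n)]_x F x).
rewrite ge0_integral_pushforward//; last exact: measurable_consV.
rewrite -[LHS]/(\int[leb \x lebesgue_rV n]_z (F \o consV (n:=n)) z).
rewrite fubini_tonelli1//; last by move=> z; exact: F0.
by apply: measurableT_comp => //; exact: measurable_consV.
Qed.

Lemma measurable_consV_comp n (F : 'rV[R]_n.+1 -> \bar R) :
  measurable_fun setT F -> measurable_fun setT (F \o @consV R n).
Proof. by move=> mF; apply: measurableT_comp => //; exact: measurable_consV. Qed.

Lemma measurable_affine n (c : R) (y : 'rV[R]_n) :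
  measurable_fun setT (fun x : 'rV[R]_n => c *: x + y)%R.
Proof.
apply: measurable_fun_rV => i.
under eq_fun do rewrite !mxE.
apply: measurable_funD => //; apply: measurable_funM => //.
exact: measurable_coord.
Qed.

Lemma integral_rV_affine n (c : R) (y : 'rV[R]_n) (F : 'rV[R]_n -> \bar R) :
  c != 0%R -> measurable_fun setT F -> (forall x, 0 <= F x) ->
  \int[lebesgue_rV n]_x F (c *: x + y)%R =
  (`|c| ^- n)%:E * \int[lebesgue_rV n]_x F x.
Proof.
move=> c0; elim: n y F => [|n IH] y F mF F0.
  rewrite expr0 invr1 mul1e; apply: eq_integral => x _; congr F.
  by apply/rowP; case.
rewrite integral_rVS//; last first.
  by apply: measurableT_comp => //; exact: measurable_affine.
have yE : y = consV (y ord0 ord0, \row_j y ord0 (lift ord0 j))%R.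
  by apply/rowP => i; rewrite mxE; case: unliftP => [j|] ->//=; rewrite mxE.
have cE t v : (c *: consV (t, v) + y = consV (c * t + y ord0 ord0,
    c *: v + \row_j y ord0 (lift ord0 j)))%R.
  by apply/rowP => i; rewrite !mxE; case: unliftP => [j|] ->//=; rewrite !mxE.
have mG := measurable_consV_comp mF.
under eq_integral => t _.
  under eq_integral => v _ do rewrite cE.
  rewrite (IH _ (fun v => F (consV (c * t + y ord0 ord0, v)%R)))//; last first.
    exact: (measurable_fun_pair2 (c * t + y ord0 ord0)%R mG).
  over.
rewrite /=.
pose J s := \int[lebesgue_rV n]_v F (consV (s, v)).
have mJ : measurable_fun setT J.
  exact: (@measurable_fun_fubini_tonelli_F _ _ _ _ _ (lebesgue_rV n)
    (F \o consV (n:=n)) mG (fun z => F0 _)).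
have J0 s : 0 <= J s by apply: integral_ge0.
pose phi (t : measurableTypeR R) : measurableTypeR R := (c * t + y ord0 ord0)%R.
have mphi : measurable_fun setT phi.
  by apply: measurable_funD => //; apply: measurable_funM.
have mJa := measurableT_comp mJ mphi.
rewrite (ge0_integralZl_EFin _ _ (f1 := J \o phi))//; last first.
  by move=> t _; exact: J0.
by rewrite integral_affine// muleA -EFinM integral_rVS// exprSr invfM.
Qed.


End lebesgue_affine.

(** * Sumsets on the line *)

Section brunn_minkowski_line.
Context {R : realType}.
Local Open Scope ereal_scope.
Local Notation leb := (@lebesgue_measure R).
Implicit Types A B C : set (measurableTypeR R).

(** The translates [A + min B] and [max A + B] lie in [A + B] and share only the
    point [max A + min B]. *)
Lemma lebesgue_sumset_compact (A B C : set (measurableTypeR R)) :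
  compact (A : set R) -> compact (B : set R) -> A !=set0 -> B !=set0 ->
  measurable C ->
  (forall a b, A a -> B b -> C (a + b)%R) -> leb A + leb B <= leb C.
Proof.
move=> cA cB A0 B0 mC ABC.
have mA : measurable A by exact: compact_measurable.
have mB : measurable B by exact: compact_measurable.
have cid (X : set R) : {within X, continuous (id : R -> R)}.
  by apply: continuous_subspaceT => x; exact: cvg_id.
have [a Aa a_max] : exists2 a, A a & forall t, A t -> (t <= a)%R.
  have [a /set_mem Aa amax] := @compact_EVT_max R R id A A0 cA (cid A).
  by exists a => // t /mem_set; exact: amax.
have [b Bb b_min] : exists2 b, B b & forall t, B t -> (b <= t)%R.
  have [b /set_mem Bb bmin] := @compact_EVT_min R R id B B0 cB (cid B).
  by exists b => // t /mem_set; exact: bmin.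
have mN (c : R) (X : set (measurableTypeR R)) : measurable X ->
    measurable ((fun t : measurableTypeR R => t + c)%R @^-1` X).
  move=> mX; rewrite -[X in measurable X]setTI.
  by apply: (measurable_funD (f := id) (g := cst c)).
have mAD : measurable (A `\ a) by exact: measurableD.
have <- : leb (A `\ a) = leb A.
  rewrite [RHS](measureDI _ mA (measurable_set1 a)) [X in _ + X](_ : _ = 0) ?adde0//.
  apply/eqP; rewrite -measure_le0 -(lebesgue_measure_set1 a).
  by apply: le_measure; rewrite ?inE//; exact: measurableI.
rewrite -(lebesgue_measure_shift (- b) mAD) -(lebesgue_measure_shift (- a) mB).
rewrite -measureU; [|exact: mN|exact: mN|].
  apply: le_measure; rewrite ?inE//.
    by apply: measurableU; exact: mN.
  move=> t [[/= At _]|/= Bt].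
    by rewrite -(subrK b t); exact: ABC.
  by rewrite -(subrK a t) addrC; exact: ABC.
apply/seteqP; split => // t [[/= At ta] Bt]; apply: ta.
have := a_max _ At; have := b_min _ Bt => h1 h2.
by apply/eqP; rewrite eq_le; lra.
Qed.

Lemma lebesgue_sumset A B C :
  measurable A -> measurable B -> measurable C -> A !=set0 -> B !=set0 ->
  (forall a b, A a -> B b -> C (a + b)%R) -> leb A + leb B <= leb C.
Proof.
move=> mA mB mC [a0 Aa0] [b0 Bb0] ABC.
have key (K L : set R) : compact K -> K `<=` A -> compact L -> L `<=` B ->
    leb K + leb L <= leb C.
  move=> cK KA cL LB.
  have cK0 : compact (K `|` [set a0]) by apply: compactU => //; exact: compact_set1.
  have cL0 : compact (L `|` [set b0]) by apply: compactU => //; exact: compact_set1.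
  apply: le_trans (lebesgue_sumset_compact cK0 cL0 _ _ mC _).
  - apply: leeD; apply: le_measure; rewrite ?inE;
      by [exact: compact_measurable|exact: subsetUl].
  - by exists a0; right.
  - by exists b0; right.
  - move=> a b Ka Lb; apply: ABC.
    + by case: Ka => [/KA//|->].
    + by case: Lb => [/LB//|->].
have [->|Cfin] := eqVneq (leb C) +oo; first exact: leey.
have {}Cfin : leb C \is a fin_num by rewrite ge0_fin_numE// lt_neqAle Cfin leey.
have keyA (L : set R) : compact L -> L `<=` B -> leb A + leb L <= leb C.
  move=> cL LB; have Lfin : leb L \is a fin_num.
    by rewrite ge0_fin_numE//; exact: compact_finite_measure.
  rewrite -leeBrDr// lebesgue_regularity_inner_sup//.
  by apply: ge_ereal_sup => _ [K [cK KA] <-]; rewrite leeBrDr//; exact: key.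
have Afin : leb A \is a fin_num.
  have := @keyA set0 compact0 (@sub0set _ B); rewrite measure0 adde0 => AC.
  by rewrite ge0_fin_numE// (le_lt_trans AC)// -ge0_fin_numE.
rewrite -leeBrDl// (lebesgue_regularity_inner_sup mB).
by apply: ge_ereal_sup => _ [L [cL LB] <-]; rewrite leeBrDl//; exact: keyA.
Qed.

Lemma lebesgue_convex_sumset (l : R) A B C : (0 < l < 1)%R ->
  measurable A -> measurable B -> measurable C -> A !=set0 -> B !=set0 ->
  (forall a b, A a -> B b -> C ((1 - l) * a + l * b)%R) ->
  (1 - l)%:E * leb A + l%:E * leb B <= leb C.
Proof.
move=> /andP[l0 l1] mA mB mC [a0 Aa0] [b0 Bb0] ABC.
have l'0 : (0 < 1 - l)%R by rewrite subr_gt0.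
have mS (c : R) (X : set (measurableTypeR R)) : measurable X ->
    measurable ((fun t : measurableTypeR R => c * t)%R @^-1` X).
  move=> mX; rewrite -[X in measurable X]setTI.
  by apply: (measurable_funM (f := cst c) (g := id)).
have SE (c : R) (X : set (measurableTypeR R)) : (0 < c)%R -> measurable X ->
    c%:E * leb X = leb ((fun t => c^-1 * t)%R @^-1` X).
  move=> c0 mX; rewrite [RHS](lebesgue_measure_scale _ mX) ?invrK//.
  by rewrite invr_gt0.
rewrite !SE//; apply: lebesgue_sumset => //; try exact: mS.
- by exists ((1 - l) * a0)%R; rewrite /= mulKf// gt_eqF.
- by exists (l * b0)%R; rewrite /= mulKf// gt_eqF.
- move=> a b /= Aa Bb; have := ABC _ _ Aa Bb.
  by rewrite !mulVKf// gt_eqF.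
Qed.

End brunn_minkowski_line.

(** * Power means *)

Section power_mean.
Context {R : realType}.
Implicit Types (p l a b x y : R).

Definition pmean p l a b := ((1 - l) * a `^ p + l * b `^ p) `^ p^-1.

Lemma pmean_ge0 p l a b : 0 <= pmean p l a b.
Proof. exact: powR_ge0. Qed.

Lemma pmean_gt0 p l a b : 0 < l < 1 -> 0 < a -> 0 < b -> 0 < pmean p l a b.
Proof.
move=> /andP[l0 l1] a0 b0; rewrite powR_gt0// addr_gt0// mulr_gt0 ?powR_gt0//.
by rewrite subr_gt0.
Qed.

Lemma pmeanZ p l c a b : p != 0 -> 0 <= l <= 1 -> 0 <= c -> 0 <= a -> 0 <= b ->
  pmean p l (c * a) (c * b) = c * pmean p l a b.
Proof.
move=> p0 /andP[l0 l1] c0 a0 b0; have l'0 : 0 <= 1 - l by rewrite subr_ge0.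
rewrite /pmean !powRM//.
have -> : (1 - l) * (c `^ p * a `^ p) + l * (c `^ p * b `^ p) =
    c `^ p * ((1 - l) * a `^ p + l * b `^ p) by ring.
rewrite powRM ?powR_ge0//.
  by rewrite -powRrM mulfV// powRr1.
by rewrite addr_ge0// mulr_ge0// powR_ge0.
Qed.

Lemma pmean_id p l a : p != 0 -> 0 <= a -> pmean p l a a = a.
Proof.
move=> p0 a0; rewrite /pmean -mulrDl subrK mul1r -powRrM mulfV//.
by rewrite powRr1.
Qed.

(** Hölder's inequality for the two-point measure with masses [1 - l] and [l]. *)
Lemma hoelder_mean l p q (a b x y : R) : 0 <= l <= 1 -> 0 < p -> 0 < q ->
  p^-1 + q^-1 = 1 -> 0 <= a -> 0 <= b -> 0 <= x -> 0 <= y ->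
  (1 - l) * (a * x) + l * (b * y) <=
  ((1 - l) * a `^ p + l * b `^ p) `^ p^-1 *
  ((1 - l) * x `^ q + l * y `^ q) `^ q^-1.
Proof.
move=> /andP[l0 l1] p0 q0 pq a0 b0 x0 y0.
have l'0 : 0 <= 1 - l by rewrite subr_ge0.
have split_weight (w : R) : 0 <= w -> w = w `^ p^-1 * w `^ q^-1.
  move=> w0; have [->|w_neq0] := eqVneq w 0.
    by rewrite powR0 ?mul0r// invr_neq0// gt_eqF.
  by rewrite -powRD ?pq ?powRr1// oner_eq0.
have powK (r w u : R) : 0 < r -> 0 <= w -> 0 <= u -> w * u `^ r = (w `^ r^-1 * u) `^ r.
  move=> r0 w0 u0; rewrite powRM ?powR_ge0// -powRrM mulVf ?gt_eqF//.
  by rewrite powRr1.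
rewrite !(powK p)// !(powK q)//.
apply: le_trans (hoelder2 _ _ _ _ p0 q0 pq); rewrite ?mulr_ge0 ?powR_ge0//.
by rewrite ![(_ `^ _ * _) * (_ `^ _ * _)]mulrACA -!split_weight.
Qed.

(** The exponent [p / (1 + p)] is the one for which [1 / p] grows by one; this
    is what integrating out one variable costs. *)
Lemma pmean_mul_le p l a b x y : 0 < p -> 0 <= l <= 1 ->
  0 <= a -> 0 <= b -> 0 <= x -> 0 <= y ->
  pmean (p / (1 + p)) l (a * x) (b * y) <=
  pmean p l a b * ((1 - l) * x + l * y).
Proof.
move=> p0 l01 a0 b0 x0 y0; have /andP[l0 l1] := l01.
have l'0 : 0 <= 1 - l by rewrite subr_ge0.
have p1 : 0 < 1 + p by rewrite addr_gt0.
have p_neq0 : p != 0 by rewrite gt_eqF.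
have p1_neq0 : 1 + p != 0 by rewrite gt_eqF.
set p' := p / (1 + p); have p'0 : 0 < p' by rewrite divr_gt0.
have := @hoelder_mean l (1 + p) p'^-1 (a `^ p') (b `^ p') (x `^ p') (y `^ p').
move=> /(_ l01 p1); rewrite invr_gt0 => /(_ p'0).
rewrite invrK -!powRrM mulfV ?(gt_eqF p'0)// !powRr1// !powR_ge0.
have -> : p' * (1 + p) = p by rewrite /p' divfK.
have -> : (1 + p)^-1 + p' = 1 by rewrite /p'; field.
move=> /(_ erefl isT isT isT isT) le1.
rewrite {1}/pmean !powRM//.
have S0 : 0 <= (1 - l) * a `^ p + l * b `^ p.
  by rewrite addr_ge0// mulr_ge0// powR_ge0.
have T0 : 0 <= (1 - l) * x + l * y by rewrite addr_ge0// mulr_ge0.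
have -> : pmean p l a b * ((1 - l) * x + l * y) =
  (((1 - l) * a `^ p + l * b `^ p) `^ (1 + p)^-1 *
   ((1 - l) * x + l * y) `^ p') `^ p'^-1.
  rewrite powRM ?powR_ge0// -!powRrM mulfV ?(gt_eqF p'0)// powRr1//.
  by congr (_ `^ _ * _); rewrite /p'; field; rewrite p_neq0 p1_neq0.
apply: ge0_ler_powR; rewrite ?nnegrE ?invr_ge0 ?(ltW p'0)//.
  by rewrite addr_ge0// mulr_ge0// mulr_ge0// powR_ge0.
by rewrite mulr_ge0// powR_ge0.
Qed.

Lemma pmean_half_mul_le p l a b x y : 0 < p -> 0 <= l <= 1 ->
  0 <= a -> 0 <= b -> 0 <= x -> 0 <= y ->
  pmean (p / 2) l (a * x) (b * y) <= pmean p l a b * pmean p l x y.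
Proof.
move=> p0 l01 a0 b0 x0 y0; have /andP[l0 l1] := l01.
have l'0 : 0 <= 1 - l by rewrite subr_ge0.
have p_neq0 : p != 0 by rewrite gt_eqF.
have := @hoelder_mean l 2 2 (a `^ (p / 2)) (b `^ (p / 2)) (x `^ (p / 2))
  (y `^ (p / 2)) l01.
rewrite -!powRrM divfK ?pnatr_eq0// !powR_ge0.
have -> : 2^-1 + 2^-1 = 1 :> R by lra.
move=> /(_ (ltr0n _ 2) (ltr0n _ 2) erefl isT isT isT isT) le1.
rewrite {1}/pmean !powRM//.
have S0 (u v : R) : 0 <= (1 - l) * u `^ p + l * v `^ p.
  by rewrite addr_ge0// mulr_ge0// powR_ge0.
have -> : pmean p l a b * pmean p l x y =
  (((1 - l) * a `^ p + l * b `^ p) `^ 2^-1 *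
   ((1 - l) * x `^ p + l * y `^ p) `^ 2^-1) `^ (p / 2)^-1.
  have pE : 2^-1 * (p / 2)^-1 = p^-1 by field.
  have powE (z : R) : (z `^ 2^-1) `^ (p / 2)^-1 = z `^ p^-1 by rewrite -powRrM pE.
  rewrite (powRM _ (powR_ge0 _ _) (powR_ge0 _ _)).
  by congr (_ * _); exact/esym/powE.
apply: ge0_ler_powR; rewrite ?nnegrE ?invr_ge0 ?divr_ge0 ?(ltW p0)//.
  by rewrite addr_ge0// mulr_ge0// mulr_ge0// powR_ge0.
by rewrite mulr_ge0// powR_ge0.
Qed.

End power_mean.

(** * The Borell-Brascamp-Lieb inequality *)

Section layer_cake.
Context {R : realType}.
Local Open Scope ereal_scope.
Local Notation leb := (@lebesgue_measure R).
Local Notation T := (measurableTypeR R).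
Variables (M : R) (w : T -> \bar R).
Hypotheses (M0 : (0 < M)%R) (mw : measurable_fun setT w) (w0 : forall x, 0 <= w x).

(** Heights are rescaled to the unit interval, so that the level sets of functions
    with different suprema can be compared at the same parameter. *)
Definition superlevel : set (T * T) :=
  [set z | (0 < z.1 < 1)%R /\ (M * z.1)%:E < w z.2].
Definition superlevel_eq : set (T * T) :=
  [set z | (0 < z.1 < 1)%R /\ (M * z.1)%:E <= w z.2].

Let mfst : measurable_fun setT (fun z : T * T => (M * z.1)%:E).
Proof.
by apply/measurable_EFinP/measurable_funM => //; exact: measurable_fst.
Qed.

Let msnd : measurable_fun setT (fun z : T * T => w z.2).
Proof. by apply: measurableT_comp => //; exact: measurable_snd. Qed.

Let mI : measurable [set z : T * T | (0 < z.1 < 1)%R].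
Proof.
rewrite (_ : [set _ | _] = `]0%R, 1%R[%classic `*` setT).
  exact: measurableX.
by apply/seteqP; split => -[u x] /=; rewrite in_itv//= => -[].
Qed.

Lemma measurable_superlevel : measurable superlevel.
Proof.
rewrite (_ : superlevel = [set z | (0 < z.1 < 1)%R] `&`
    (setT `&` [set z | (M * z.1)%:E < w z.2])); last first.
  by rewrite setTI.
by apply: measurableI => //; exact: measurable_lte.
Qed.

Lemma measurable_superlevel_eq : measurable superlevel_eq.
Proof.
rewrite (_ : superlevel_eq = [set z | (0 < z.1 < 1)%R] `&`
    ~` (setT `&` [set z | w z.2 < (M * z.1)%:E])); last first.
  rewrite setTI; apply/seteqP; split => z /= [z01 zw]; split => //.
    by apply/negP; rewrite -leNgt.
  by rewrite leNgt; apply/negP.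
by apply: measurableI => //; apply: measurableC; exact: measurable_lte.
Qed.

Let exchange (E : set (T * T)) : measurable E ->
  \int[leb]_u leb (xsection E u) = \int[leb]_x leb (ysection E x).
Proof.
move=> mE; have := indic_fubini_tonelli leb leb mE.
by rewrite indic_fubini_tonelli_FE// indic_fubini_tonelli_GE.
Qed.

Lemma integral_superlevel : (forall x, w x <= M%:E) ->
  \int[leb]_u leb (xsection superlevel u) = M^-1%:E * \int[leb]_x w x.
Proof.
move=> wM; rewrite exchange; last exact: measurable_superlevel.
rewrite -ge0_integralZl_EFin ?invr_ge0 ?(ltW M0)//.
apply: eq_integral => x _.
have wfin : w x \is a fin_num.
  by rewrite ge0_fin_numE// (le_lt_trans (wM x)) ?ltry.
have := wM x; have := w0 x; rewrite -(fineK wfin) !lee_fin.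
set r := fine (w x) => r0 rM.
rewrite (_ : ysection _ _ = `]0%R, (M^-1 * r)%R[%classic).
  rewrite lebesgue_measure_itv/= lte_fin; case: ifPn => [_|].
    by rewrite oppr0 adde0 EFinM.
  rewrite -leNgt pmulr_rle0 ?invr_gt0// => r0'.
  have -> : r = 0%R by apply/eqP; rewrite eq_le r0 r0'.
  by rewrite mule0.
apply/seteqP; split => u; rewrite /= in_itv/= /ysection/= inE /superlevel/=;
  rewrite -(fineK wfin) lte_fin -/r ltr_pdivlMl//.
  by move=> [/andP[-> _] ->].
move=> /andP[u0 ur]; split => //; rewrite u0 /=.
by rewrite -(ltr_pM2l M0) mulr1 (lt_le_trans ur).
Qed.

Lemma integral_superlevel_eq :
  \int[leb]_u leb (xsection superlevel_eq u) <= M^-1%:E * \int[leb]_x w x.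
Proof.
rewrite exchange; last exact: measurable_superlevel_eq.
rewrite -ge0_integralZl_EFin ?invr_ge0 ?(ltW M0)//.
apply: ge0_le_integral_gen => x; first exact: measure_ge0.
have [->|wfin] := eqVneq (w x) +oo.
  by rewrite gt0_muley ?leey// lte_fin invr_gt0.
have {}wfin : w x \is a fin_num by rewrite ge0_fin_numE// lt_neqAle wfin leey.
have := w0 x; rewrite -(fineK wfin) lee_fin; set r := fine (w x) => r0.
have -> : M^-1%:E * r%:E = leb `]0%R, (M^-1 * r)%R]%classic.
  rewrite lebesgue_measure_itv/= lte_fin; case: ifPn => [_|].
    by rewrite oppr0 adde0 EFinM.
  rewrite -leNgt pmulr_rle0 ?invr_gt0// => r0'.
  have -> : r = 0%R by apply/eqP; rewrite eq_le r0 r0'.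
  by rewrite mule0.
apply: le_measure; rewrite ?inE//.
  by apply: measurable_ysection; exact: measurable_superlevel_eq.
move=> u; rewrite /= in_itv/= /ysection/= inE /superlevel_eq/=.
by rewrite -(fineK wfin) lee_fin -/r ler_pdivlMl// => -[/andP[-> _] ->].
Qed.

End layer_cake.

Section borell_brascamp_lieb.
Context {R : realType}.
Local Open Scope ereal_scope.
Local Notation leb := (@lebesgue_measure R).
Local Notation T := (measurableTypeR R).

(** Quantifying over the reals strictly below [u] and [v] gives the power mean
    its value in the limit where [u] or [v] is infinite. It is also void when [u]
    or [v] vanishes, as the inequality requires. *)
Definition dominates_pmean (p l : R) (u v w : \bar R) :=
  forall a b : R, (0 < a)%R -> (0 < b)%R -> a%:E < u -> b%:E < v ->
    (pmean p l a b)%:E <= w.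

(** After normalizing [f] and [g] by their suprema, the level sets of [h]
    contain the convex combinations of the level sets of [f] and [g] at the same
    height, so that the one-dimensional Brunn-Minkowski inequality applies height
    by height. *)
Lemma bbl_line_bounded (p l : R) (f g : T -> R) (h : T -> \bar R) (a b : R) :
  (0 < p)%R -> (0 < l < 1)%R ->
  measurable_fun setT f -> measurable_fun setT g -> measurable_fun setT h ->
  (forall x, 0 <= f x)%R -> (forall x, 0 <= g x)%R -> (forall x, 0 <= h x) ->
  has_ubound (range f) -> has_ubound (range g) ->
  (forall x y, dominates_pmean p l (f x)%:E (g y)%:E
    (h ((1 - l) * x + l * y)%R)) ->
  (0 < a)%R -> (0 < b)%R ->
  a%:E < \int[leb]_x (f x)%:E -> b%:E < \int[leb]_x (g x)%:E ->
  (pmean (p / (1 + p)) l a b)%:E <= \int[leb]_x h x.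
Proof.
move=> p0 l01 mf mg mh f0 g0 h0 ubf ubg fgh a0 b0 af bg.
have /andP[l0 l1] := l01; have l'0 : (0 < 1 - l)%R by rewrite subr_gt0.
have l01' : (0 <= l <= 1)%R by rewrite !ltW.
have sup_pos (k : T -> R) (c : R) : (forall x, 0 <= k x)%R ->
    has_ubound (range k) -> (0 < c)%R -> c%:E < \int[leb]_x (k x)%:E ->
    (0 < sup (range k))%R /\ forall x, (k x <= sup (range k))%R.
  move=> k0 ubk c0 ck.
  have hs : has_sup (range k) by split => //; exists (k 0%R), 0%R.
  have le_sup x : (k x <= sup (range k))%R.
    by apply: sup_upper_bound => //; exists x.
  split=> //; rewrite ltNge; apply/negP => sup0.
  move: ck; rewrite integral0_eq ?lte_fin ?ltNge ?(ltW c0)// => x _.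
  by congr (_%:E); apply/eqP; rewrite eq_le k0 (le_trans (le_sup x)).
have [A0 fA] := sup_pos f a f0 ubf a0 af.
have [B0 gB] := sup_pos g b g0 ubg b0 bg.
set A := sup (range f) in A0 fA; set B := sup (range g) in B0 gB.
set M := pmean p l A B; have M0 : (0 < M)%R by exact: pmean_gt0.
have mf' : measurable_fun setT (EFin \o f) by exact/measurable_EFinP.
have mg' : measurable_fun setT (EFin \o g) by exact/measurable_EFinP.
have level u : (1 - l)%:E * leb (xsection (superlevel A (EFin \o f)) u) +
    l%:E * leb (xsection (superlevel B (EFin \o g)) u) <=
    leb (xsection (superlevel_eq M h) u).
  have [u01|u01] := boolP (0 < u < 1)%R; last first.
    have empty c (k : T -> \bar R) : xsection (superlevel c k) u = set0.
      apply/seteqP; split => // x; rewrite /xsection/= inE /superlevel/=.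
      by rewrite (negbTE u01) => -[].
    by rewrite !empty measure0 !mule0 adde0.
  have /andP[u0 u1] := u01.
  have nonempty (k : T -> R) : has_ubound (range k) -> (0 < sup (range k))%R ->
      xsection (superlevel (sup (range k)) (EFin \o k)) u !=set0.
    move=> ubk S0; have hs : has_sup (range k).
      by split => //; exists (k 0%R), 0%R.
    have [|_ [x _ <-] kx] := @sup_gt _ (range k) (sup (range k) * u)%R hs.1.
      by rewrite gtr_pMr.
    by exists x; rewrite /xsection/= inE /superlevel/= lte_fin.
  apply: lebesgue_convex_sumset => //.
  - by apply: measurable_xsection; exact: measurable_superlevel.
  - by apply: measurable_xsection; exact: measurable_superlevel.
  - by apply: measurable_xsection; exact: measurable_superlevel_eq.
  - exact: nonempty.
  - exact: nonempty.
  move=> x y; rewrite /xsection/= !inE /superlevel/superlevel_eq/=.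
  move=> [_ fx] [_ gy]; split => //.
  rewrite mulrC -pmeanZ ?(gt_eqF p0) ?(ltW u0) ?(ltW A0) ?(ltW B0)//.
  by apply: fgh => //; rewrite ?mulr_gt0// mulrC.
have mxs (E : set (T * T)) : measurable E -> measurable_fun setT (leb \o xsection E).
  by move=> mE; exact: (measurable_fun_xsection leb).
have int_h : (M * ((1 - l) * (A^-1 * a) + l * (B^-1 * b)))%:E <= \int[leb]_x h x.
  rewrite EFinM -lee_pdivlMl//; apply: le_trans (integral_superlevel_eq M0 mh h0).
  apply: le_trans; last first.
    apply: ge0_le_integral_gen => u; last exact: level.
    by rewrite adde_ge0// mule_ge0 ?measure_ge0// lee_fin ltW.
  rewrite ge0_integralD//; last 4 first.
  - by move=> u _; rewrite mule_ge0 ?measure_ge0// lee_fin ltW.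
  - by apply: measurable_funeM; apply: mxs; exact: measurable_superlevel.
  - by move=> u _; rewrite mule_ge0 ?measure_ge0// lee_fin ltW.
  - by apply: measurable_funeM; apply: mxs; exact: measurable_superlevel.
  rewrite !ge0_integralZl_EFin ?(ltW l0) ?(ltW l'0)//; last 2 first.
  - by apply: mxs; exact: measurable_superlevel.
  - by apply: mxs; exact: measurable_superlevel.
  rewrite !integral_superlevel//.
  rewrite EFinD !EFinM; apply: leeD; rewrite lee_pmul2l ?lte_fin// lee_pmul2l//;
    by rewrite ?lte_fin ?invr_gt0// ltW.
apply: le_trans int_h; rewrite lee_fin.
have := @pmean_mul_le R p l A B (A^-1 * a) (B^-1 * b) p0 l01'.
rewrite !mulVKf ?gt_eqF//; apply; rewrite ?mulr_ge0 ?invr_ge0 ?ltW//.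
Qed.

Import HBNNSimple.

(** Simple functions are bounded. *)
Lemma integral_gt_bounded (F : T -> \bar R) (a : R) : (forall x, 0 <= F x) ->
  a%:E < \int[leb]_x F x -> exists f : T -> R, [/\ measurable_fun setT f,
    (forall x, 0 <= f x)%R, has_ubound (range f), (forall x, (f x)%:E <= F x) &
    a%:E < \int[leb]_x (f x)%:E].
Proof.
move=> F0; rewrite (@ge0_integralTE _ _ _ leb _ F0) => /ereal_sup_gt[_ [u /= uF <-] au].
exists u; split => //.
- exact/bounded_fun_has_ubound/simple_bounded.
- by rewrite integralT_nnsfun.
Qed.

Lemma bbl_line (p l : R) (F G H : T -> \bar R) :
  (0 < p)%R -> (0 < l < 1)%R -> measurable_fun setT H ->
  (forall x, 0 <= F x) -> (forall x, 0 <= G x) -> (forall x, 0 <= H x) ->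
  (forall x y, dominates_pmean p l (F x) (G y) (H ((1 - l) * x + l * y)%R)) ->
  dominates_pmean (p / (1 + p)) l (\int[leb]_x F x) (\int[leb]_x G x)
    (\int[leb]_x H x).
Proof.
move=> p0 l01 mH F0 G0 H0 FGH a b a0 b0.
move=> /(integral_gt_bounded F0)[f [mf f0 ubf fF af]].
move=> /(integral_gt_bounded G0)[g [mg g0 ubg gG bg]].
apply: (bbl_line_bounded p0 l01 mf mg mH f0 g0 H0 ubf ubg _ a0 b0 af bg).
move=> x y c d c0 d0 cf dg; apply: FGH => //.
- exact: lt_le_trans (fF x).
- exact: lt_le_trans (gG y).
Qed.

(** The exponent [q] is read off from [1 / q = 1 / p + n], which is stable under
    the induction on [n]. *)
Lemma bbl_rV n (p q l : R) (F G H : 'rV[R]_n -> \bar R) :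
  (0 < p)%R -> (0 < l < 1)%R -> (q^-1 = p^-1 + n%:R)%R ->
  measurable_fun setT F -> measurable_fun setT G -> measurable_fun setT H ->
  (forall x, 0 <= F x) -> (forall x, 0 <= G x) -> (forall x, 0 <= H x) ->
  (forall x y, dominates_pmean p l (F x) (G y) (H ((1 - l) *: x + l *: y)%R)) ->
  dominates_pmean q l (\int[lebesgue_rV n]_x F x)
    (\int[lebesgue_rV n]_x G x) (\int[lebesgue_rV n]_x H x).
Proof.
move=> p0 l01; elim: n q F G H => [|n IH] q F G H qE mF mG mH F0 G0 H0 FGH.
  have {qE} -> : q = p by apply: invr_inj; rewrite qE addr0.
  have eval (K : 'rV[R]_0 -> \bar R) : measurable_fun setT K ->
      \int[lebesgue_rV 0]_x K x = K (0 : 'rV[R]_0)%R.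
    move=> mK; rewrite -[LHS]/(\int[\d_(0%R : 'rV[R]_0)]_x K x).
    by rewrite integral_dirac// diracE mem_set// mul1e.
  rewrite !eval//; have := FGH (0 : 'rV[R]_0)%R (0 : 'rV[R]_0)%R.
  by rewrite !scaler0 addr0.
pose q' := ((p^-1 + n%:R)^-1)%R.
have q'0 : (0 < q')%R by rewrite invr_gt0 ltr_wpDr// invr_gt0.
have -> : (q = q' / (1 + q'))%R.
  apply: invr_inj; rewrite qE invf_div mulrDl mul1r mulfV ?gt_eqF//.
  by rewrite /q' invrK -natr1 addrA.
rewrite !integral_rVS//; apply: bbl_line => //.
- apply: (@measurable_fun_fubini_tonelli_F _ _ _ _ _ (lebesgue_rV n)
    (H \o consV (n:=n)) (measurable_consV_comp mH) (fun z => H0 _)).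
- by move=> t; exact: integral_ge0.
- by move=> t; exact: integral_ge0.
- by move=> t; exact: integral_ge0.
move=> t0 t1; apply: IH => //.
- by rewrite invrK.
- exact: (measurable_fun_pair2 t0 (measurable_consV_comp mF)).
- exact: (measurable_fun_pair2 t1 (measurable_consV_comp mG)).
- exact: (measurable_fun_pair2 _ (measurable_consV_comp mH)).
move=> x y; have := FGH (consV (t0, x)) (consV (t1, y)).
suff -> : ((1 - l) *: consV (t0, x) + l *: consV (t1, y) =
    consV ((1 - l) * t0 + l * t1, (1 - l) *: x + l *: y))%R by [].
by apply/rowP => i; rewrite !mxE; case: unliftP => [j|] _ //=; rewrite !mxE.
Qed.

End borell_brascamp_lieb.

(** * Integrals of powers *)

Section power_integrals.
Context {R : realType}.
Local Open Scope ereal_scope.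
Local Notation leb := (@lebesgue_measure R).

Lemma continuous_powR (r x : R) : (0 < x)%R -> {for x, continuous (@powR R ^~ r)}.
Proof.
move=> x0; apply: differentiable_continuous; apply/derivable1_diffP.
by apply: ex_derive; exact: is_derive1_powR.
Qed.

Lemma integral_powR_tail (N t0 : R) : (0 < N)%R -> (0 < t0)%R ->
  \int[leb]_(t in `[t0, +oo[) (t `^ (- N - 1))%:E = (t0 `^ (- N) / N)%:E.
Proof.
move=> N0 t0_gt0; pose F (t : R) : R := (- N^-1 * t `^ (- N))%R.
have dF (x : R) : (0 < x)%R -> is_derive x 1%R F (x `^ (- N - 1))%R.
  move=> x0; have := is_deriveZ (- N^-1) (is_derive1_powR (- N) x0).
  by rewrite [X in is_derive _ _ _ X](_ : _ = (x `^ (- N - 1))%R)//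
    scalerA mulrNN mulVf ?gt_eqF// scale1r.
rewrite (@ge0_continuous_FTC2y _ _ F _ 0%R).
- by rewrite sub0e /F -EFinN mulNr opprK mulrC.
- by move=> x _; exact: powR_ge0.
- apply: continuous_in_subspaceT => x /set_mem; rewrite /= in_itv/= andbT => xt.
  by apply: continuous_powR; exact: lt_le_trans xt.
- rewrite /F -[X in _ --> X](mulr0 (- N^-1)%R); apply: cvgM; first exact: cvg_cst.
  apply: (@cvg_trans _ (expR (- (N * ln t))%R @[t --> +oo%R])).
    apply: near_eq_cvg; near=> t; rewrite /powR gt_eqF 1?mulNr//.
  apply: (@cvg_comp _ _ _ (fun t => N * ln t)%R (fun u => expR (- u)) _ (pinfty_nbhs R)).
    apply: gt0_cvgMry => //; apply/cvgryPge => A; near=> t.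
    have tA : (expR A <= t)%R by near: t; exact: nbhs_pinfty_ge.
    by rewrite -ler_expR lnK// posrE (lt_le_trans _ tA)// expR_gt0.
  exact: cvgr_expR.
- by move=> x tx; apply: ex_derive; apply: dF; exact: lt_trans tx.
- apply: cvg_at_right_filter.
  apply: differentiable_continuous; apply/derivable1_diffP; apply: ex_derive.
  exact: dF.
- move=> x; rewrite in_itv/= andbT => tx; rewrite derive1E.
  by have [_ ->] := dF x (lt_trans t0_gt0 tx).
Unshelve. all: by end_near. Qed.

Lemma integral_powR_near0 (a : R) : (0 < a)%R ->
  \int[leb]_(t in `]0%R, 1%R]) (t `^ (a - 1))%:E < +oo.
Proof.
move=> a0; pose F (t : R) : R := (a^-1 * t `^ a)%R.
have dF (x : R) : (0 < x)%R -> is_derive x 1%R F (x `^ (a - 1))%R.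
  move=> x0; have := is_deriveZ (a^-1) (is_derive1_powR a x0).
  by rewrite [X in is_derive _ _ _ X](_ : _ = (x `^ (a - 1))%R)//
    scalerA mulVf ?gt_eqF// scale1r.
have cF (x : R) : (0 < x)%R -> {for x, continuous F}.
  move=> x0; apply: differentiable_continuous; apply/derivable1_diffP.
  by apply: ex_derive; exact: dF.
pose S k : set R := `[(k.+2%:R^-1)%R, 1%R]%classic.
have S0 k x : S k x -> (0 < x)%R.
  by rewrite /S/= in_itv/= => /andP[+ _]; apply: lt_le_trans; rewrite invr_gt0.
have SE : \bigcup_k S k = `]0%R, 1%R]%classic.
  apply/seteqP; split => [x [k _]|x].
    by move=> /[dup] /S0 x0; rewrite /S/= !in_itv/= x0 => /andP[_ ->].
  rewrite /= in_itv/= => /andP[x0 x1].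
  exists (Num.truncn x^-1) => //; rewrite /S/= in_itv/= x1 andbT.
  rewrite invf_ple ?posrE//.
  by rewrite (le_trans (ltW (truncnS_gt _)))// ler_nat.
rewrite -SE; apply: (@le_lt_trans _ _ (a^-1)%:E); last exact: ltry.
have mp k : measurable_fun (S k : set (measurableTypeR R))
    (fun t : measurableTypeR R => (t `^ (a - 1))%:E).
  by apply/measurable_EFinP; apply: measurable_funTS; exact: measurable_powR.
have cvgS := @ge0_nondecreasing_set_cvg_integral _ (measurableTypeR R) R S
  (fun t : measurableTypeR R => (t `^ (a - 1))%:E) leb.
have {}cvgS := cvgS _ _ mp _.
have Snd : {homo S : n m / (n <= m)%N >-> n <= m}%O.
  move=> i j ij; rewrite subsetEset => x; rewrite /S/= !in_itv/= => /andP[xi ->].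
  by rewrite andbT (le_trans _ xi)// lef_pV2 ?posrE// ler_nat.
have {}cvgS := cvgS Snd (fun i => measurable_itv _) _.
have {}cvgS : \int[leb]_(x in S i) (x `^ (a - 1))%:E @[i --> \oo] -->
    \int[leb]_(x in \bigcup_i S i) (x `^ (a - 1))%:E.
  by apply: cvgS => i x _; rewrite lee_fin powR_ge0.
rewrite -(cvg_lim _ cvgS)//.
- apply: lime_le; first exact: cvgP cvgS.
  apply: nearW => k.
  rewrite (@continuous_FTC2 _ _ F).
  + rewrite -EFinB lee_fin /F powR1 mulr1 gerBl.
    by rewrite mulr_ge0 ?powR_ge0// invr_ge0 ltW.
  + by rewrite invf_lt1// ltr1n.
  + apply: continuous_in_subspaceT => x /set_mem /S0; exact: continuous_powR.
  + split.
    * move=> x; rewrite in_itv/= => /andP[kx _]; apply: ex_derive; apply: dF.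
      by apply: lt_trans kx; rewrite invr_gt0.
    * by apply: cvg_at_right_filter; apply: cF; rewrite invr_gt0.
    * by apply: cvg_at_left_filter; apply: cF.
  + move=> x; rewrite in_itv/= => /andP[kx _]; rewrite derive1E.
    by have [|_ ->] := dF x; first by apply: lt_trans kx; rewrite invr_gt0.
Qed.

End power_integrals.

(** * Berwald's inequality on a ray *)

Section beta_moment.
Context {R : realType}.
Local Open Scope ereal_scope.
Local Notation leb := (@lebesgue_measure R).
Local Notation T := (measurableTypeR R).
Implicit Types (a b k r t : R).

Definition moment a (phi : R -> R) : \bar R :=
  \int[leb]_(t in `]0%R, +oo[) ((t `^ (a - 1))%:E * (phi t)%:E).

(** The extremal profile: its [1 / k]-th power is affine on its support. *)
Definition tent k r t : R := ((Num.max 0 (1 - t / r)) `^ k)%R.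

Lemma tent_ge0 k r t : (0 <= tent k r t)%R. Proof. exact: powR_ge0. Qed.

Lemma tent_le1 k r t : (0 <= k)%R -> (0 < r)%R -> (0 <= t)%R ->
  (tent k r t <= 1)%R.
Proof.
move=> k0 r0 t0; have -> : (1 = 1 `^ k :> R)%R by rewrite powR1.
apply: ge0_ler_powR; rewrite ?nnegrE ?le_max ?lexx//.
by rewrite ge_max ler01 gerBl divr_ge0 ?(ltW r0).
Qed.

Lemma measurable_tent k r : measurable_fun [set: T] (tent k r : T -> R).
Proof.
apply: (@measurableT_comp _ _ _ _ _ _ (@powR R ^~ k)).
  exact: measurable_powR.
apply: measurable_maxr => //; apply: measurable_funB => //.
exact: measurable_funM.
Qed.

Lemma moment_ge0 a phi : (forall t, 0 <= phi t)%R -> 0 <= moment a phi.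
Proof.
by move=> phi0; apply: integral_ge0 => t _; rewrite mule_ge0 ?lee_fin ?powR_ge0.
Qed.

Lemma moment_le a phi psi : (forall t, 0 <= phi t)%R ->
  (forall t, 0 < t -> phi t <= psi t)%R -> moment a phi <= moment a psi.
Proof.
move=> phi0 le_phi; rewrite /moment integral_mkcond [leRHS]integral_mkcond.
apply: ge0_le_integral_gen => t; rewrite !patchE; case: ifPn => // /set_mem.
  by move=> _; rewrite mule_ge0 ?lee_fin ?powR_ge0.
rewrite /= in_itv/= andbT => t0.
by rewrite lee_wpmul2l ?lee_fin ?powR_ge0//; exact: le_phi.
Qed.

Lemma momentZ a c phi : (0 <= c)%R -> measurable_fun [set: T] (phi : T -> R) ->
  (forall t, 0 <= phi t)%R ->
  moment a (fun t => c * phi t)%R = c%:E * moment a phi.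
Proof.
move=> c0 mphi phi0; rewrite /moment -ge0_integralZl_EFin//.
- by apply: eq_integral => t _; rewrite EFinM muleCA.
- by move=> t _; rewrite mule_ge0 ?lee_fin ?powR_ge0.
- apply: measurable_funTS; apply: emeasurable_funM; apply/measurable_EFinP => //.
Qed.

Lemma moment_tent1 a k : (0 < k)%R -> moment a (tent k 1) =
  \int[leb]_(t in `[0%R, 1%R]) (t `^ (a - 1) * (1 - t) `^ k)%:E.
Proof.
move=> k0; rewrite -integral_itv_obnd_cbnd; last first.
  apply/measurable_EFinP; apply: measurable_funTS; apply: measurable_funM.
    exact: measurable_powR.
  apply: (@measurableT_comp _ _ _ _ _ _ (@powR R ^~ k)).
    exact: measurable_powR.
  exact: measurable_funB.
rewrite /moment integral_mkcond [RHS]integral_mkcond; apply: eq_integral => t _.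
rewrite !patchE !mem_setE !in_itv/= andbT /tent divr1.
case: ifPn => //= t0; have [t1|t1] := leP t 1%R.
  by rewrite EFinM max_r// subr_ge0.
by rewrite max_l ?powR0 ?gt_eqF ?mule0// subr_le0 ltW.
Qed.

Lemma moment_tent1_fin a k : (0 < a)%R -> (0 < k)%R ->
  moment a (tent k 1) \is a fin_num.
Proof.
move=> a0 k0; rewrite ge0_fin_numE; last by apply: moment_ge0 => t; exact: tent_ge0.
apply: le_lt_trans (integral_powR_near0 a0).
rewrite /moment integral_mkcond [leRHS]integral_mkcond.
apply: ge0_le_integral_gen => t; rewrite !patchE; case: ifPn => // tp.
- by rewrite mule_ge0 ?lee_fin ?powR_ge0.
- move: tp; rewrite !mem_setE !in_itv/= andbT => t0; rewrite t0/=.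
  have [t1|t1] := leP t 1%R.
    rewrite -[leRHS]mule1 lee_wpmul2l ?lee_fin ?powR_ge0//.
    by rewrite tent_le1 ?(ltW k0) ?(ltW t0).
  by rewrite /tent divr1 max_l ?powR0 ?gt_eqF ?mule0// subr_le0 ltW.
- by case: ifPn => // _; rewrite lee_fin powR_ge0.
Qed.

Lemma moment_tent1_beta a k : (0 < a)%R -> (0 < k)%R ->
  moment a (tent k 1) = (beta a (k + 1))%:E.
Proof.
move=> a0 k0; rewrite /beta /Rintegral addrK -(moment_tent1 a k0) fineK//.
exact: moment_tent1_fin.
Qed.

Lemma beta_gt0 a k : (0 < a)%R -> (0 < k)%R -> (0 < beta a (k + 1))%R.
Proof.
move=> a0 k0; rewrite -lte_fin -moment_tent1_beta//.
pose c : R := (2^-1 `^ a * 4^-1 `^ k)%R.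
have c0 : (0 < c)%R by rewrite mulr_gt0// powR_gt0 ?invr_gt0.
pose I : set R := `[2^-1%R, (3 / 4)%R]%classic.
have cE : (c * (3 / 4 - 2^-1))%:E = \int[leb]_(t in I) (cst c%:E) t.
  rewrite integral_cst; last exact: measurable_itv.
  rewrite [X in _ * X](lebesgue_measure_itv `[2^-1%R, (3 / 4)%R]) /= lte_fin ifT.
    by rewrite EFinM.
  by lra.
have : 0 < (c * (3 / 4 - 2^-1))%:E by rewrite lte_fin mulr_gt0//; lra.
move/lt_le_trans; apply; rewrite cE /moment integral_mkcond.
rewrite [leRHS]integral_mkcond; apply: ge0_le_integral_gen => t.
  by rewrite patchE; case: ifPn => // _; rewrite lee_fin ltW.
rewrite !patchE /I !mem_setE !in_itv/= andbT.
case: ifPn => [/andP[t1 t2]|_]; last first.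
  by case: ifPn => // _; rewrite mule_ge0 ?lee_fin ?powR_ge0.
have t0 : (0 < t)%R by lra.
rewrite t0 -EFinM lee_fin; apply: ler_pM; rewrite ?powR_ge0//.
  apply: (@le_trans _ _ (t `^ a)%R).
    by apply: ge0_ler_powR; rewrite ?nnegrE; lra.
  by apply: ger_powR; lra.
rewrite /tent divr1 max_r; last by lra.
by apply: ge0_ler_powR; rewrite ?nnegrE; lra.
Qed.

Lemma moment_tent a k r : (0 < a)%R -> (0 < k)%R -> (0 < r)%R ->
  moment a (tent k r) = (r `^ a * beta a (k + 1))%:E.
Proof.
move=> a0 k0 r0; rewrite EFinM -moment_tent1_beta// /moment.
pose F (t : R) : \bar R := (t `^ (a - 1))%:E * (tent k 1 t)%:E.
rewrite [X in _ = _ * X]integral_mkcond [LHS]integral_mkcond.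
pose F0 : R -> \bar R := F \_ `]0%R, +oo[.
have F0_ge0 t : 0 <= F0 t.
  by apply: erestrict_ge0 => u _; rewrite mule_ge0// lee_fin powR_ge0.
have rV0 : (0 < r^-1)%R by rewrite invr_gt0.
have -> : (r `^ a = r `^ (a - 1) / r^-1)%R.
  by rewrite invrK mulrC mulr_powRB1 ?ltW.
rewrite -[RHS](integral_scale rV0 (powR_gt0 (a - 1) r0) F0_ge0).
apply: eq_integral => t _; rewrite /F0 !patchE !mem_setE !in_itv/= !andbT.
rewrite pmulr_rgt0//; case: ifPn => [t0|_]; last by rewrite mule0.
rewrite /F muleA -EFinM; congr (_%:E * _%:E).
  by rewrite -powRM ?mulr_ge0 ?ltW// mulVKf ?gt_eqF.
by rewrite /tent divr1 mulrC.
Qed.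

End beta_moment.

Section berwald.
Context {R : realType}.
Local Open Scope ereal_scope.
Local Notation leb := (@lebesgue_measure R).
Local Notation T := (measurableTypeR R).
Variables (k G : R) (phi : R -> R).
Hypotheses (k0 : (0 < k)%R) (G0 : (0 < G)%R).
Hypotheses (mphi : measurable_fun [set: T] (phi : T -> R)).
Hypotheses (phi0 : forall t, (0 <= phi t)%R).
(** Concavity of [phi ^ (1 / k)] along the chords issued from [0]. *)
Hypothesis phi_conc : forall t l : R, (0 < t)%R -> (0 < l < 1)%R ->
  (0 < phi t)%R -> (pmean k^-1 l G (phi t) <= phi ((l * t)%R))%R.

Lemma ray_gt_tent (r t u : R) : (0 < r)%R -> (0 < u < t)%R ->
  (G * tent k r t < phi t)%R -> (G * tent k r u <= phi u)%R.
Proof.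
move=> r0 /andP[u0 ut] lt_phi; have t0 := lt_trans u0 ut.
have phit0 : (0 < phi t)%R.
  by apply: le_lt_trans lt_phi; rewrite mulr_ge0 ?tent_ge0 ?ltW.
pose l := (u / t)%R; have ul : u = (l * t)%R by rewrite /l divfK ?gt_eqF.
have l01 : (0 < l < 1)%R by rewrite divr_gt0//= ltr_pdivrMr// mul1r.
have /andP[l0 l1] := l01.
have S0 (x y q : R) : (0 <= (1 - l) * x `^ q + l * y `^ q)%R.
  by rewrite addr_ge0// mulr_ge0 ?powR_ge0// ?subr_ge0 ltW.
rewrite {2}ul; apply: le_trans (phi_conc t0 l01 phit0).
apply: (@le_trans _ _ (pmean k^-1 l (G * 1) (G * tent k r t))%R); last first.
  rewrite mulr1 /pmean invrK; apply: ge0_ler_powR; rewrite ?nnegrE ?(ltW k0)//.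
  rewrite lerD2l ler_pM2l//; apply: ge0_ler_powR.
  - by rewrite invr_ge0 ltW.
  - by rewrite nnegrE mulr_ge0 ?tent_ge0 ?(ltW G0).
  - by rewrite nnegrE ltW.
  - exact: ltW.
rewrite pmeanZ ?invr_eq0 ?gt_eqF ?tent_ge0 ?(ltW l0) ?(ltW l1) ?(ltW G0)//.
rewrite ler_pM2l// /pmean invrK powR1 mulr1 /tent -powRrM mulfV ?gt_eqF//.
pose w : R := (Num.max 0 (1 - t / r))%R; rewrite -/w.
have w0 : (0 <= w)%R by rewrite /w le_max lexx.
have w1 : (1 - t / r <= w)%R by rewrite /w le_max lexx orbT.
clearbody w.
rewrite powRr1//; apply: ge0_ler_powR; rewrite ?nnegrE ?(ltW k0)//.
- by rewrite le_max lexx.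
- by have := mulr_ge0 (ltW l0) w0; lra.
have lw1 := ler_wpM2l (ltW l0) w1; have lw0 := mulr_ge0 (ltW l0) w0.
rewrite ge_max ul -(mulrA l t); clearbody l.
move: (t / r)%R lw1 => q; rewrite mulrBr mulr1 => lw1.
by apply/andP; split; lra.
Qed.

(** A positive concave function on a half-line, here [phi ^ (1 / k)], is
    nondecreasing. *)
Lemma ray_const : (forall t, 0 < t -> 0 < phi t)%R ->
  forall t : R, (0 < t)%R -> (G <= phi t)%R.
Proof.
move=> phi_gt0 t t0; rewrite leNgt; apply/negP => phiG.
pose r := (phi t `^ k^-1 / G `^ k^-1)%R.
have Gk : (0 < G `^ k^-1)%R by rewrite powR_gt0.
have r0 : (0 < r)%R by rewrite divr_gt0// powR_gt0// phi_gt0.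
have r1 : (r < 1)%R.
  rewrite ltr_pdivrMr// mul1r; apply: gt0_ltr_powR; rewrite ?invr_gt0 ?nnegrE//.
  exact: ltW.
pose l := ((1 - r) / 2)%R; have l01 : (0 < l < 1)%R by rewrite /l; lra.
have /andP[l0 l1] := l01.
have tl0 : (0 < t / l)%R by rewrite divr_gt0.
have := phi_conc tl0 l01 (phi_gt0 _ tl0).
rewrite (mulrC l) divfK ?gt_eqF// leNgt => /negP; apply.
apply: (@le_lt_trans _ _ ((r * G `^ k^-1) `^ k)%R).
  rewrite /r divfK ?gt_eqF// -powRrM mulVf ?gt_eqF// powRr1//.
rewrite /pmean invrK; apply: gt0_ltr_powR => //; rewrite ?nnegrE.
- by rewrite mulr_ge0 ?ltW.
- by rewrite addr_ge0// mulr_ge0 ?powR_ge0//; lra.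
apply: (@lt_le_trans _ _ ((1 - l) * G `^ k^-1)%R).
  by rewrite ltr_pM2r// /l; lra.
by rewrite lerDl mulr_ge0 ?powR_ge0 ?ltW.
Qed.

Lemma moment_Gtent (a r : R) : (0 < a)%R -> (0 < r)%R ->
  moment a (fun t => G * tent k r t)%R = (G * (r `^ a * beta a (k + 1)))%:E.
Proof.
move=> a0 r0; rewrite momentZ ?(ltW G0)//.
- by rewrite moment_tent// EFinM.
- exact: measurable_tent.
- by move=> t; exact: tent_ge0.
Qed.

(** The comparison function [G (1 - t / r)_+ ^ k] has an affine [1/k]-th power
    with the same value at [0], so that [phi] crosses it at most once, from above
    to below. Weighting by [t ^ (b - a)], which gives more mass to the
    part behind the crossing, turns the order of the [a]-th moments into the order
    of the [b]-th moments. *)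
Lemma berwald_le (a b r : R) : (0 < a)%R -> (a < b)%R -> (0 < r)%R ->
  moment a phi <= (G * (r `^ a * beta a (k + 1)))%:E ->
  moment b phi <= (G * (r `^ b * beta b (k + 1)))%:E.
Proof.
move=> a0 ab r0 le_a; have b0 := lt_trans a0 ab.
have B0 := beta_gt0 a0 k0.
pose P : set R := [set t | (0 < t)%R /\ (G * tent k r t < phi t)%R].
have [ubP|] := pselect (has_ubound P); last first.
  (* Here [phi] is positive everywhere, hence at least [G], and its moment exceeds
     that of a tent twice as wide. *)
  move=> unbP.
  have phi_gt0 t : (0 < t)%R -> (0 < phi t)%R.
    move=> t0; apply: contrapT => /negP phit; apply: unbP; exists t => u [u0 lt_phi].
    rewrite leNgt; apply/negP => tu; move: phit; apply/negP; rewrite negbK.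
    pose l := (t / u)%R; have tE : t = (l * u)%R by rewrite /l divfK ?gt_eqF.
    have l01 : (0 < l < 1)%R by rewrite divr_gt0//= ltr_pdivrMr// mul1r.
    have phiu : (0 < phi u)%R.
      by apply: le_lt_trans lt_phi; rewrite mulr_ge0 ?tent_ge0 ?ltW.
    by rewrite tE; apply: lt_le_trans (phi_conc u0 l01 phiu); exact: pmean_gt0.
  have phiG := ray_const phi_gt0.
  have : moment a (fun t => G * tent k (2 * r) t)%R <= moment a phi.
    apply: moment_le => t; first by rewrite mulr_ge0 ?tent_ge0 ?ltW.
    move=> t0; apply: le_trans (phiG _ t0); rewrite ger_pMr//.
    by rewrite tent_le1 ?mulr_gt0 ?(ltW k0) ?(ltW t0).
  have r20 : (0 < 2 * r)%R by rewrite mulr_gt0.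
  rewrite (moment_Gtent a0 r20) => /le_trans /(_ le_a).
  rewrite lee_fin (ler_pM2l G0) (ler_pM2r B0) leNgt => /negP[].
  apply: (gt0_ltr_powR a0); rewrite ?nnegrE; [exact: ltW|exact: ltW|].
  by rewrite ltr_pMl// ltr1n.
pose t0 := sup (P `|` [set 0%R]).
have hs : has_sup (P `|` [set 0%R]).
  split; first by exists 0%R; right.
  case: ubP => M PM; exists (Num.max M 0)%R => x [/PM xM|->].
    by rewrite le_max xM.
  by rewrite le_max lexx orbT.
have t0_ge0 : (0 <= t0)%R by apply: sup_upper_bound => //; right.
pose c := (t0 `^ (b - a))%R; have c0 : (0 <= c)%R by exact: powR_ge0.
have m_pow p (psi : T -> R) : measurable_fun setT psi ->
    measurable_fun (`]0%R, +oo[%classic : set T)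
      (fun t : T => (t `^ (p - 1))%:E * (psi t)%:E).
  move=> mpsi; apply: measurable_funTS; apply: emeasurable_funM;
    apply/measurable_EFinP => //; exact: measurable_powR.
have m_chi : measurable_fun [set: T] (fun t : T => G * tent k r t)%R.
  by apply: measurable_funM => //; exact: measurable_tent.
have key : moment b phi + c%:E * moment a (fun t => G * tent k r t)%R <=
    moment b (fun t => G * tent k r t)%R + c%:E * moment a phi.
  rewrite -!momentZ//; last first.
    by move=> t; rewrite mulr_ge0 ?tent_ge0 ?ltW.
  rewrite /moment -!ge0_integralD//=; first last.
  all: try (by apply: m_pow => //; apply: measurable_funM).
  all: try (by move=> t _;
    rewrite mule_ge0 ?lee_fin ?powR_ge0 ?mulr_ge0 ?tent_ge0 ?(ltW G0)).
  rewrite integral_mkcond [leRHS]integral_mkcond.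
  apply: ge0_le_integral_gen => t; rewrite !patchE; case: ifPn => //.
    by move=> _; rewrite adde_ge0// mule_ge0// lee_fin ?powR_ge0 ?mulr_ge0
      ?tent_ge0 ?(ltW G0).
  rewrite mem_setE in_itv/= andbT => tp; rewrite -!EFinM -!EFinD lee_fin.
  set chi := (G * tent k r t)%R.
  have -> : (t `^ (b - 1) = t `^ (a - 1) * t `^ (b - a))%R.
    rewrite [X in (t `^ X)%R](_ : _ = (a - 1) + (b - a))%R; last by ring.
    by rewrite powRD// (gt_eqF tp) implybT.
  have ta0 : (0 <= t `^ (a - 1))%R by exact: powR_ge0.
  suff : (0 <= (c - t `^ (b - a)) * (phi t - chi))%R.
    by move=> /(mulr_ge0 ta0); nra.
  have ba0 : (0 <= b - a)%R by rewrite subr_ge0 ltW.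
  have [tt0|t0t|tt0] := ltgtP t t0; last first.
  - by rewrite /c tt0 subrr mul0r.
  - rewrite -mulrNN mulr_ge0// oppr_ge0 subr_le0.
      by apply: ge0_ler_powR; rewrite ?nnegrE//; exact: ltW.
    rewrite leNgt; apply/negP => Pt; move: t0t; rewrite ltNge => /negP; apply.
    by apply: sup_upper_bound => //; left.
  - rewrite mulr_ge0// subr_ge0; first by apply: ge0_ler_powR; rewrite ?nnegrE//; exact: ltW.
    have [u [[u0 Pu]|->] tu] := sup_gt (proj1 hs) tt0.
      by apply: (ray_gt_tent r0 _ Pu); rewrite tp tu.
    by move: tu; rewrite ltNge ltW.

move: key; rewrite (moment_Gtent a0 r0) (moment_Gtent b0 r0) => key.
have : moment b phi + c%:E * (G * (r `^ a * beta a (k + 1)))%:E <=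
    (G * (r `^ b * beta b (k + 1)))%:E + c%:E * (G * (r `^ a * beta a (k + 1)))%:E.
  by apply: le_trans key _; rewrite leeD2l// lee_wpmul2l.
by rewrite leeD2rE// -EFinM.
Qed.

Lemma berwald_level (a b r : R) : (0 < a)%R -> (a < b)%R -> (0 < r)%R ->
  (G * (r `^ b * beta b (k + 1)))%:E <= moment b phi ->
  (G * (r `^ a * beta a (k + 1)))%:E <= moment a phi.
Proof.
move=> a0 ab r0 le_b; have b0 := lt_trans a0 ab.
have Ba := beta_gt0 a0 k0; have Bb := beta_gt0 b0 k0.
rewrite leNgt; apply/negP => lt_a; move: le_b; apply/negP; rewrite -ltNge.
have Ma0 : 0 <= moment a phi by exact: moment_ge0.
have Mfin : moment a phi \is a fin_num.
  by rewrite ge0_fin_numE// (lt_trans lt_a)// ltry.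
pose v := (fine (moment a phi) / (G * beta a (k + 1)))%R.
have GB0 : (0 < G * beta a (k + 1))%R := mulr_gt0 G0 Ba.
have v0 : (0 <= v)%R by rewrite divr_ge0 ?fine_ge0// ltW.
have vr : (v < r `^ a)%R.
  by rewrite ltr_pdivrMr// mulrCA -lte_fin fineK.
have ra0 : (0 < r `^ a)%R by rewrite powR_gt0.
(* Any radius strictly between will do. *)
pose r' := (((v + r `^ a) / 2) `^ a^-1)%R.
have m0 : (0 < (v + r `^ a) / 2)%R by lra.
have r'0 : (0 < r')%R by rewrite powR_gt0.
have r'a : (r' `^ a = (v + r `^ a) / 2)%R.
  by rewrite /r' -powRrM mulVf ?gt_eqF// powRr1// ltW.
have r'r : (r' < r)%R.
  rewrite ltNge; apply/negP => rr'.
  have : (r `^ a <= r' `^ a)%R by apply: ge0_ler_powR; rewrite ?nnegrE// ltW.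
  by rewrite r'a; lra.
apply: (@le_lt_trans _ _ (G * (r' `^ b * beta b (k + 1)))%:E).
  apply: (berwald_le a0 ab r'0).
  rewrite -(fineK Mfin) lee_fin mulrCA -ler_pdivrMr// -/v r'a; lra.
rewrite lte_fin (ltr_pM2l G0) (ltr_pM2r Bb).
by apply: (gt0_ltr_powR b0) => //; rewrite nnegrE ltW.
Qed.

(** If [phi] vanishes at some [t1 > 0] it vanishes beyond, so that it is bounded by
    a multiple of a tent and has finite moments; otherwise [ray_const] applies. *)
Lemma moment_infty a : (0 < a)%R -> (forall t, phi t <= G)%R ->
  moment a phi = +oo -> forall t : R, (0 < t)%R -> (G <= phi t)%R.
Proof.
move=> a0 phiG Moo; apply: ray_const => t1 t10.
rewrite lt_neqAle phi0 andbT; apply/eqP => phit1.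
have phi_vanish (t : R) : (t1 < t)%R -> phi t = 0%R.
  move=> t1t; apply: contrapT => /eqP phit_neq0.
  have t0 := lt_trans t10 t1t.
  have phit : (0 < phi t)%R by rewrite lt_neqAle eq_sym phit_neq0 phi0.
  have l01 : (0 < t1 / t < 1)%R by rewrite divr_gt0//= ltr_pdivrMr// mul1r.
  have := phi_conc t0 l01 phit; rewrite divfK ?gt_eqF// -phit1 leNgt.
  by move=> /negP; apply; exact: pmean_gt0.
have c0 : (0 < 2 `^ k)%R by rewrite powR_gt0.
have : moment a phi <= moment a (fun t => 2 `^ k * (G * tent k (2 * t1) t))%R.
  apply: moment_le => // t t0; have [tt1|tt1] := leP t t1; last first.
    by rewrite phi_vanish// !mulr_ge0 ?tent_ge0 ?(ltW c0) ?(ltW G0).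
  apply: le_trans (phiG t) _; rewrite mulrCA ler_pMr// /tent -powRM ?le_max ?lexx//.
  have {1}-> : (1 = 1 `^ k :> R)%R by rewrite powR1.
  have tq : (t / (2 * t1) <= 2^-1)%R.
    by rewrite ler_pdivrMr ?mulr_gt0// mulrA mulVf ?mul1r.
  apply: ge0_ler_powR; rewrite ?nnegrE ?(ltW k0) ?mulr_ge0 ?le_max ?lexx//.
  by rewrite max_r; lra.
rewrite momentZ ?(ltW c0)//; last 2 first.
- by apply: measurable_funM => //; exact: measurable_tent.
- by move=> t; rewrite mulr_ge0 ?tent_ge0 ?(ltW G0).
by rewrite moment_Gtent ?mulr_gt0// Moo -EFinM leye_eq.
Qed.

End berwald.

(** * The correlation function *)

Section correlation.
Context {R : realType} {n : nat}.
Local Open Scope ereal_scope.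
Local Notation mu := (@lebesgue_rV R n).
Local Notation V := 'rV[R]_n.
Implicit Types (f h u v : V -> R).

Lemma measurable_affine_preimage (c : R) (y : V) (A : set V) : measurable A ->
  measurable [set x : V | A (c *: x + y)%R].
Proof.
by move=> mA; have := measurable_affine c y measurableT mA; rewrite setTI.
Qed.

Lemma lebesgue_rV_affine (c : R) (y : V) (A : set V) : c != 0%R ->
  measurable A ->
  mu [set x : V | A (c *: x + y)%R] = (`|c| ^- n)%:E * mu A.
Proof.
move=> c0 mA; have mI : measurable_fun setT (fun x : V => (\1_A x : R)%:E).
  by apply/measurable_EFinP; exact: measurable_indic.
have := integral_rV_affine y c0 mI.
rewrite integral_indic//; last exact: measurable_affine_preimage.
by rewrite integral_indic// !setIT; apply => x; rewrite lee_fin.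
Qed.

Lemma ae_lebesgue_rV_affine (P : V -> Prop) (c : R) (y : V) : c != 0%R ->
  {ae mu, forall x, P x} -> {ae mu, forall x, P (c *: x + y)%R}.
Proof.
move=> c0 [N [mN N0 PN]]; exists [set x : V | N (c *: x + y)%R]; split.
- exact: measurable_affine_preimage.
- by rewrite lebesgue_rV_affine// N0 mule0.
- by move=> x /= Pxy; exact: PN.
Qed.

(** Off a null set [f] is a Borel function; on that set it is squeezed between
    [0] and its bound. *)
Lemma square_integrable_squeeze f (M : R) : (forall x, 0 <= f x <= M)%R ->
  square_integrable f -> exists u v, [/\ measurable_fun setT u,
    measurable_fun setT v, (forall x, 0 <= u x /\ u x <= f x /\ f x <= v x)%R,
    {ae mu, forall x, u x = v x} & \int[mu]_x ((u x) ^+ 2)%:E < +oo].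
Proof.
move=> fM [g gL [N [mN N0 fgN]]].
have mg : measurable_fun setT g by have := sub_Lfun_mfun gL; rewrite inE.
have fg x : ~ N x -> f x = g x.
  by move=> Nx; apply: contrapT => fgx; apply: Nx; exact: fgN.
pose u x : R := (g x * \1_(~` N) x)%R.
have mu_ : measurable_fun setT u.
  by apply: measurable_funM => //; apply: measurable_indic; exact: measurableC.
have uE x : (u x = if x \in N then 0 else f x)%R.
  rewrite /u indicE in_setC; case: ifPn => [_|/negP xN]; first by rewrite mulr0.
  by rewrite mulr1 fg// => /mem_set.
exists u, (fun x => u x + M * \1_N x)%R; split => //.
- by apply: measurable_funD => //; apply: measurable_funM.
- move=> x; have /andP[f0 f1] := fM x; rewrite uE indicE.
  by case: ifPn => _; rewrite ?mulr1 ?mulr0 ?add0r ?addr0.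
- exists N; split => // x /= uv; apply: contrapT => xN; apply: uv.
  by rewrite indicE memNset// mulr0 addr0.
- have := Lfun2_integrable_sqr gL => /integrableP[_].
  apply: le_lt_trans; apply: ge0_le_integral_gen => x.
    by rewrite lee_fin sqr_ge0.
  rewrite lee_fin/= ger0_norm ?sqr_ge0// /u indicE.
  by case: (_ \in _); rewrite ?mulr1// mulr0 expr0n/= sqr_ge0.
Qed.

Definition corr f h (y : V) : \bar R := \int[mu]_x (h x * f (x + y)%R)%:E.

Lemma corr_ge0 f h y : (forall x, 0 <= f x)%R -> (forall x, 0 <= h x)%R ->
  0 <= corr f h y.
Proof. by move=> f0 h0; apply: integral_ge0 => x _; rewrite lee_fin mulr_ge0. Qed.

Lemma eq_corr f h u v y : (forall x, 0 <= f x)%R -> (forall x, 0 <= h x)%R ->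
  (forall x, 0 <= u x)%R -> (forall x, 0 <= v x)%R ->
  {ae mu, forall x, f x = u x} -> {ae mu, forall x, h x = v x} ->
  corr f h y = corr u v y.
Proof.
move=> f0 h0 u0 v0 fu hv; apply: ae_eq_integral_gen.
- by move=> x; rewrite lee_fin mulr_ge0.
- by move=> x; rewrite lee_fin mulr_ge0.
apply: filterS2 (ae_lebesgue_rV_affine y (oner_neq0 R) fu) hv => x /= + ->.
by rewrite scale1r => ->.
Qed.

Lemma measurable_corr_integrand f h : measurable_fun setT f ->
  measurable_fun setT h ->
  measurable_fun setT (fun z : V * V => (h z.2 * f (z.2 + z.1))%:E).
Proof.
move=> mf mh; apply/measurable_EFinP; apply: measurable_funM.
  by apply: measurableT_comp => //; exact: measurable_snd.
apply: measurableT_comp => //; apply: measurable_fun_rV => i.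
under eq_fun do rewrite mxE.
apply: measurable_funD.
  apply: (measurableT_comp (measurable_coord i)); exact: measurable_snd.
apply: (measurableT_comp (measurable_coord i)); exact: measurable_fst.
Qed.

Lemma measurable_corr f h : (forall x, 0 <= f x)%R -> (forall x, 0 <= h x)%R ->
  measurable_fun setT f -> measurable_fun setT h ->
  measurable_fun setT (corr f h).
Proof.
move=> f0 h0 mf mh.
apply: (@measurable_fun_fubini_tonelli_F _ _ _ _ _ mu _
  (measurable_corr_integrand mf mh)) => z.
by rewrite lee_fin mulr_ge0.
Qed.

Lemma integral_corr f h : (forall x, 0 <= f x)%R -> (forall x, 0 <= h x)%R ->
  measurable_fun setT f -> measurable_fun setT h ->
  \int[mu]_y corr f h y = \int[mu]_x (f x)%:E * \int[mu]_x (h x)%:E.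
Proof.
move=> f0 h0 mf mh; rewrite /corr.
have mf' : measurable_fun setT (EFin \o f) by exact/measurable_EFinP.
have mh' : measurable_fun setT (EFin \o h) by exact/measurable_EFinP.
rewrite (@fubini_tonelli _ _ _ _ _ mu mu _ (measurable_corr_integrand mf mh));
  last by move=> z; rewrite lee_fin mulr_ge0.
rewrite muleC -ge0_integralZr//; last 2 first.
- by move=> x _; rewrite lee_fin.
- by apply: integral_ge0 => x _; rewrite lee_fin.
apply: eq_integral => x _ /=.
under eq_integral do rewrite EFinM.
rewrite ge0_integralZl_EFin//; last first.
- have := measurableT_comp mf' (measurable_affine 1%R x).
  by apply: eq_measurable_fun => y _; rewrite /= scale1r addrC.
- by move=> y _; rewrite lee_fin.
congr (_ * _); have := integral_rV_affine x (oner_neq0 R) mf'.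
rewrite normr1 expr1n invr1 mul1e => <-; last by move=> y; rewrite lee_fin.
by apply: eq_integral => y _; rewrite scale1r addrC.
Qed.

Lemma corrN f h y : (forall x, 0 <= f x)%R -> (forall x, 0 <= h x)%R ->
  measurable_fun setT f -> measurable_fun setT h ->
  corr f h (- y)%R = corr (f \o -%R) (h \o -%R) y.
Proof.
move=> f0 h0 mf mh; rewrite /corr.
have m1 : (-1 != 0 :> R)%R by rewrite oppr_eq0 oner_neq0.
pose F x := (h x * f (x - y)%R)%:E.
have mF : measurable_fun setT F.
  exact: (measurable_fun_pair2 (- y)%R (measurable_corr_integrand mf mh)).
have F0 x : 0 <= F x by rewrite lee_fin mulr_ge0.
have := integral_rV_affine 0%R m1 mF F0.
rewrite normrN1 expr1n invr1 mul1e => <-.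
by apply: eq_integral => x _; rewrite /F/= addr0 scaleN1r opprD.
Qed.

Lemma corr_L2_lty f h y : measurable_fun setT f -> measurable_fun setT h ->
  (forall x, 0 <= f x)%R -> (forall x, 0 <= h x)%R ->
  \int[mu]_x ((f x) ^+ 2)%:E < +oo -> \int[mu]_x ((h x) ^+ 2)%:E < +oo ->
  corr f h y < +oo.
Proof.
move=> mf mh f0 h0 f2 h2.
have mf2 : measurable_fun setT (fun x : V => (f x ^+ 2)%:E).
  by apply/measurable_EFinP; exact: measurable_funX.
have mh2 : measurable_fun setT (fun x : V => (h x ^+ 2)%:E).
  by apply/measurable_EFinP; exact: measurable_funX.
have f20 x : 0 <= (f x ^+ 2)%:E by rewrite lee_fin sqr_ge0.
have f2y : \int[mu]_x ((f (x + y)%R) ^+ 2)%:E = \int[mu]_x ((f x) ^+ 2)%:E.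
  have := integral_rV_affine y (oner_neq0 R) mf2 f20.
  rewrite normr1 expr1n invr1 mul1e => <-.
  by apply: eq_integral => x _; rewrite scale1r.
have mf2y : measurable_fun setT (fun x : V => ((f (x + y)%R) ^+ 2)%:E).
  have := measurableT_comp mf2 (measurable_affine 1%R y).
  by apply: eq_measurable_fun => x _; rewrite /= scale1r.
apply: (@le_lt_trans _ _ (\int[mu]_x ((h x ^+ 2)%:E + (f (x + y)%R ^+ 2)%:E))).
  apply: ge0_le_integral_gen => x; first by rewrite lee_fin mulr_ge0.
  rewrite -EFinD lee_fin.
  have := sqr_ge0 (h x - f (x + y)%R)%R.
  have := sqr_ge0 (h x + f (x + y)%R)%R.
  by rewrite sqrrB sqrrD; lra.
rewrite ge0_integralD//; last by move=> x _; rewrite lee_fin sqr_ge0.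
by rewrite f2y lte_add_pinfty.
Qed.

End correlation.

Section correlation_concave.
Context {R : realType} {n : nat}.
Local Open Scope ereal_scope.
Local Notation mu := (@lebesgue_rV R n).
Local Notation V := 'rV[R]_n.
Implicit Types (f h u v : V -> R).

Lemma pmean_le (p l a b c d : R) : (0 < p)%R -> (0 <= l <= 1)%R ->
  (0 <= a <= c)%R -> (0 <= b <= d)%R -> (pmean p l a b <= pmean p l c d)%R.
Proof.
move=> p0 /andP[l0 l1] /andP[a0 ac] /andP[b0 bd].
have l'0 : (0 <= 1 - l)%R by rewrite subr_ge0.
have c0 := le_trans a0 ac; have d0 := le_trans b0 bd.
apply: ge0_ler_powR; rewrite ?nnegrE ?addr_ge0 ?mulr_ge0 ?powR_ge0//.
  by rewrite invr_ge0 ltW.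
by apply: lerD; apply: ler_wpM2l => //; apply: ge0_ler_powR => //; exact: ltW.
Qed.

Lemma s_concave_pmean (s l : R) f x y : (0 < s)%R -> (forall x, 0 <= f x)%R ->
  s_concave_on_support s f -> (0 < f x)%R -> (0 < f y)%R -> (0 <= l <= 1)%R ->
  (pmean s l (f x) (f y) <= f ((1 - l) *: x + l *: y))%R.
Proof.
move=> s0 f0 [_ fc] fx fy /[dup] l01 /andP[l0 l1].
set z := f (_ + _)%R; have -> : (z = (z `^ s) `^ s^-1)%R.
  by rewrite -powRrM mulfV ?gt_eqF// powRr1// /z.
apply: ge0_ler_powR; rewrite ?nnegrE ?powR_ge0//.
- by rewrite invr_ge0 ltW.
- by rewrite addr_ge0// mulr_ge0 ?powR_ge0// subr_ge0.
- exact: fc.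
Qed.

Lemma even_s_concave_le0 (s : R) f x : (0 < s)%R -> (forall x, 0 <= f x)%R ->
  even_fun f -> s_concave_on_support s f -> (f x <= f 0)%R.
Proof.
move=> s0 f0 fE fc; have := f0 x; rewrite le_eqVlt => /predU1P[<-//|fx].
have fNx : (0 < f (- x))%R by rewrite fE.
have l01 : (0 <= (2^-1 : R) <= 1)%R by apply/andP; split; lra.
have := s_concave_pmean s0 f0 fc fx fNx l01.
rewrite fE pmean_id ?gt_eqF ?(ltW fx)// scalerN -scalerBl.
by rewrite (_ : 1 - 2^-1 - 2^-1 = 0)%R ?scale0r//; lra.
Qed.

(** The product of two [s]-concave functions is [s / 2]-concave, and integrating
    out [n] variables turns [2 / s] into [2 / s + n]. *)
Lemma corr_concave (s l : R) f h (y0 y1 : V) : (0 < s)%R -> (0 < l < 1)%R ->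
  (forall x, 0 <= f x <= f 0)%R -> (forall x, 0 <= h x <= h 0)%R ->
  square_integrable f -> square_integrable h ->
  s_concave_on_support s f -> s_concave_on_support s h ->
  dominates_pmean (n%:R + 2 / s)^-1 l (corr f h y0) (corr f h y1)
    (corr f h ((1 - l) *: y0 + l *: y1)%R).
Proof.
move=> s0 l01 fM hM fL hL fc hc.
have f0 x : (0 <= f x)%R by have /andP[] := fM x.
have h0 x : (0 <= h x)%R by have /andP[] := hM x.
have [fl [fu [mfl mfu fB flu _]]] := square_integrable_squeeze fM fL.
have [hl [hu [mhl mhu hB hlu _]]] := square_integrable_squeeze hM hL.
have fl0 x : (0 <= fl x)%R by have [] := fB x.
have hl0 x : (0 <= hl x)%R by have [] := hB x.
have flf x : (fl x <= f x)%R by have [_ []] := fB x.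
have hlh x : (hl x <= h x)%R by have [_ []] := hB x.
have ffu x : (f x <= fu x)%R by have [_ []] := fB x.
have hhu x : (h x <= hu x)%R by have [_ []] := hB x.
have fu0 x : (0 <= fu x)%R := le_trans (f0 x) (ffu x).
have hu0 x : (0 <= hu x)%R := le_trans (h0 x) (hhu x).
have fE : {ae mu, forall x, f x = fl x}.
  by apply: filterS flu => x e; apply/eqP; rewrite eq_le flf e ffu.
have hE : {ae mu, forall x, h x = hl x}.
  by apply: filterS hlu => x e; apply/eqP; rewrite eq_le hlh e hhu.
have fE' : {ae mu, forall x, f x = fu x} by apply: filterS2 fE flu => x -> ->.
have hE' : {ae mu, forall x, h x = hu x} by apply: filterS2 hE hlu => x -> ->.
rewrite (eq_corr y0 f0 h0 fl0 hl0 fE hE) (eq_corr y1 f0 h0 fl0 hl0 fE hE).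
rewrite (eq_corr _ f0 h0 fu0 hu0 fE' hE').
have s2 : (0 < s / 2)%R by rewrite divr_gt0.
have /andP[l0 l1] := l01; have l01' : (0 <= l <= 1)%R by rewrite !ltW.
have m u v (y : V) : measurable_fun setT u -> measurable_fun setT v ->
    measurable_fun setT (fun x => (v x * u (x + y)%R)%:E).
  by move=> mu_ mv; exact: (measurable_fun_pair2 y (measurable_corr_integrand mu_ mv)).
apply: (@bbl_rV R n (s / 2)) => //; try exact: m.
- by rewrite invrK invf_div addrC.
- by move=> x; rewrite lee_fin mulr_ge0.
- by move=> x; rewrite lee_fin mulr_ge0.
- by move=> x; rewrite lee_fin mulr_ge0.
move=> x0 x1 a b a0 b0; rewrite !lte_fin lee_fin => ax bx.
have le_a : (a <= h x0 * f (x0 + y0))%R.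
  by apply: le_trans (ltW ax) _; exact: ler_pM.
have le_b : (b <= h x1 * f (x1 + y1))%R.
  by apply: le_trans (ltW bx) _; exact: ler_pM.
have pos (c p q : R) : (0 < c)%R -> (c <= p * q)%R -> (0 <= p)%R -> (0 <= q)%R ->
    (0 < p)%R /\ (0 < q)%R.
  move=> c0 cpq p0 q0; rewrite !lt_neqAle p0 q0 !andbT.
  by split; apply/eqP => e; move: cpq; rewrite -e ?mul0r ?mulr0 leNgt c0.
have [hx0 fx0] := pos _ _ _ a0 le_a (h0 _) (f0 _).
have [hx1 fx1] := pos _ _ _ b0 le_b (h0 _) (f0 _).
apply: (@le_trans _ _ (pmean (s / 2) l (h x0 * f (x0 + y0)) (h x1 * f (x1 + y1)))%R).
  by apply: pmean_le => //; rewrite ?le_a ?le_b !ltW.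
apply: le_trans (pmean_half_mul_le s0 l01' _ _ _ _) _ => //.
apply: ler_pM; rewrite ?pmean_ge0//.
  by apply: le_trans (hhu _); exact: s_concave_pmean.
apply: le_trans (ffu _).
have := s_concave_pmean s0 f0 fc fx0 fx1 l01'.
rewrite !scalerDr => /le_trans; apply.
rewrite le_eqVlt; apply/orP; left; apply/eqP; congr f.
by rewrite addrACA.
Qed.

End correlation_concave.

(** * Volume of the star body in terms of the mass of a density *)

Section volume.
Context {R : realType} {n : nat}.
Local Open Scope ereal_scope.
Local Notation mu := (@lebesgue_rV R n).
Local Notation leb := (@lebesgue_measure R).
Local Notation V := 'rV[R]_n.
Local Notation T := (measurableTypeR R).
Local Notation N := (n%:R : R).
Variables (k : R) (g : V -> R).
Hypotheses (n_gt0 : (0 < n)%N) (k0 : (0 < k)%R).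
Hypotheses (mg : measurable_fun setT g) (g0 : forall y, (0 <= g y)%R).
Hypotheses (G0 : (0 < g 0)%R) (gG : forall y, (g y <= g 0)%R).
Hypothesis g_conc : forall (y : V) (l : R), (0 < l < 1)%R -> (0 < g y)%R ->
  (pmean k^-1 l (g 0) (g y) <= g (l *: y))%R.

Definition ray_moment (a : R) (xi : V) : \bar R := moment a (fun t => g (t *: xi)%R).

Let N0 : (0 < N)%R. Proof. by rewrite ltr0n. Qed.

Let pos : set T := `]0%R, +oo[%classic.

Lemma measurable_scaled : measurable_fun setT (fun z : V * T => g (z.2 *: z.1)%R).
Proof.
apply: measurableT_comp => //; apply: measurable_fun_rV => i.
under eq_fun do rewrite mxE.
apply: measurable_funM; first exact: measurable_snd.
by apply: (measurableT_comp (measurable_coord i)); exact: measurable_fst.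
Qed.

Lemma measurable_ray xi : measurable_fun setT (fun t : T => g (t *: xi)%R).
Proof. exact: (measurable_fun_pair2 xi measurable_scaled). Qed.

Let momentE (a : R) xi : ray_moment a xi =
  \int[leb]_t (t `^ (a - 1) * g (t *: xi) * \1_pos t)%:E.
Proof.
rewrite /ray_moment /moment integral_mkcond; apply: eq_integral => t _.
by rewrite patchE indicE /pos; case: ifPn => _; rewrite ?mulr1 ?mulr0// EFinM.
Qed.

Let mpowT (a : R) : measurable_fun setT (fun z : V * T => z.2 `^ a)%R.
Proof.
apply: (measurableT_comp (measurable_powR a)); exact: measurable_snd.
Qed.

Let mposT : measurable_fun setT (fun z : V * T => \1_pos z.2 : R).
Proof.
apply: measurableT_comp; last exact: measurable_snd.
by apply: measurable_indic; exact: measurable_itv.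
Qed.

Lemma measurable_ray_moment (a : R) : measurable_fun setT (ray_moment a).
Proof.
have mF : measurable_fun setT
    (fun z : V * T => (z.2 `^ (a - 1) * g (z.2 *: z.1) * \1_pos z.2)%:E).
  apply/measurable_EFinP; apply: measurable_funM => //.
  apply: measurable_funM; [exact: mpowT|exact: measurable_scaled].
have F0 (z : V * T) :
    0 <= (z.2 `^ (a - 1) * g (z.2 *: z.1) * \1_pos z.2)%:E.
  by rewrite lee_fin !mulr_ge0 ?powR_ge0// indicE.
have := @measurable_fun_fubini_tonelli_F _ _ _ _ _ leb _ mF F0.
by apply: eq_measurable_fun => xi _; rewrite momentE.
Qed.

Lemma ray_moment_ge0 (a : R) xi : 0 <= ray_moment a xi.
Proof. by apply: moment_ge0 => t. Qed.

Lemma ray_momentZ (a c : R) xi : (0 < c)%R ->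
  ray_moment a (c *: xi) = (c `^ (- a))%:E * ray_moment a xi.
Proof.
move=> c0; rewrite !momentE.
pose F (t : R) : \bar R := (t `^ (a - 1) * g (t *: xi) * \1_pos t)%:E.
have F0 t : 0 <= F t by rewrite lee_fin !mulr_ge0 ?powR_ge0// indicE.
have kk0 : (0 < c `^ (1 - a))%R by rewrite powR_gt0.
have -> : (c `^ (- a) = c `^ (1 - a) / c)%R.
  rewrite powRD ?(gt_eqF c0) ?implybT// powRr1 ?ltW//.
  by rewrite mulrAC mulfV ?(gt_eqF c0)// mul1r.
rewrite -[RHS](integral_scale c0 kk0 F0); apply: eq_integral => t _.
rewrite /F -EFinM !indicE /pos !mem_setE !in_itv/= !andbT pmulr_rgt0//.
case: ltP => [t0|_]; last by rewrite !mulr0.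
rewrite !mulr1 mulrA powRM ?(ltW c0) ?(ltW t0)// mulrA -powRD; last first.
  by rewrite (gt_eqF c0) implybT.
by rewrite (_ : 1 - a + (a - 1) = 0)%R ?powRr0 ?mul1r ?scalerA ?(mulrC c)//; ring.
Qed.

Lemma ray_moment_eq0 (a : R) xi : (0 < a)%R -> ray_moment a xi = 0 -> g xi = 0%R.
Proof.
move=> a0 nu0; apply: contrapT => /eqP gxi.
have gxi0 : (0 < g xi)%R by rewrite lt_neqAle eq_sym gxi g0.
have : moment a (fun t => g xi * tent k 1 t)%R <= ray_moment a xi.
  apply: moment_le => t; first by rewrite mulr_ge0 ?tent_ge0.
  move=> t0; have [t1|t1] := ltP t 1%R; last first.
    by rewrite /tent divr1 max_l ?subr_le0// powR0 ?gt_eqF// mulr0.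
  have t01 : (0 < t < 1)%R by rewrite t0.
  apply: le_trans (g_conc t01 gxi0).
  apply: (@le_trans _ _ (g xi)).
    by rewrite ger_pMr// tent_le1 ?(ltW k0) ?(ltW t0).
  apply: (@le_trans _ _ (pmean k^-1 t (g xi) (g xi))).
    by rewrite pmean_id ?invr_eq0 ?gt_eqF.
  by apply: pmean_le; rewrite ?invr_gt0 ?(ltW t0) ?(ltW t1) ?g0 ?gG/=.
rewrite momentZ//; last 2 first.
- exact: measurable_tent.
- by move=> t; exact: tent_ge0.
rewrite moment_tent// nu0 leNgt powR1 mul1r lte_fin mulr_gt0//.
exact: beta_gt0.
Qed.

Lemma ray_moment_infty (a : R) xi : (0 < a)%R -> ray_moment a xi = +oo ->
  g xi = g 0%R.
Proof.
move=> a0 nuoo; apply/eqP; rewrite eq_le gG /=.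
have conc (t l : R) : (0 < t)%R -> (0 < l < 1)%R -> (0 < g (t *: xi))%R ->
    (pmean k^-1 l (g 0) (g (t *: xi)) <= g ((l * t) *: xi))%R.
  by move=> _ l01 gt0; rewrite -scalerA; exact: g_conc.
have := moment_infty k0 G0 (fun t => g0 (t *: xi)%R) conc a0 (fun t => gG _) nuoo ltr01.
by rewrite scale1r.
Qed.

(** The cone of directions of infinite moment is invariant under dilations. *)
Lemma ray_moment_infty_measure (a : R) (A := [set xi | ray_moment a xi = +oo]) :
  mu A = 0 \/ mu A = +oo.
Proof.
have mA : measurable A.
  by have := measurable_ray_moment a measurableT (emeasurable_set1 +oo); rewrite setTI.
have two0 : (2 != 0 :> R)%R by rewrite pnatr_eq0.
have := lebesgue_rV_affine 0%R two0 mA.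
rewrite (_ : [set x | _] = A); last first.
  apply/seteqP; split => x; rewrite /A/= addr0 ray_momentZ//.
    move: (ray_moment_ge0 a x); by case: (ray_moment a x).
  by move=> ->; rewrite gt0_muley// lte_fin powR_gt0.
have : 0 <= mu A by exact: measure_ge0.
case: (mu A) => [r r0|_ _|//]; last by right.
rewrite -EFinM => -[re]; left; congr (_%:E).
have c1 : (`|2| ^- n < 1 :> R)%R.
  by rewrite invf_lt1 ?exprn_gt0 ?normr_gt0// gtr0_norm// exprn_egt1 ?ltr1n// -lt0n.
move: r0; rewrite lee_fin le_eqVlt => /predU1P[<-//|r0].
by move: c1; rewrite -(ltr_pM2r r0) -re mul1r ltxx.
Qed.

Let inner_integral (K v : R) : (0 < K)%R -> (0 < v)%R ->
  \int[leb]_(t in `[((K / v) `^ N^-1)%R, +oo[) (v^-1 * t `^ (- N - 1))%:E =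
  ((N * K)^-1)%:E.
Proof.
move=> K0 v0; have Kv0 : (0 < K / v)%R by rewrite divr_gt0.
under eq_integral do rewrite EFinM.
rewrite ge0_integralZl_EFin//; last 3 first.
- by move=> t _; rewrite lee_fin powR_ge0.
- by apply/measurable_EFinP; apply: measurable_funTS; exact: measurable_powR.
- by rewrite invr_ge0 ltW.
rewrite integral_powR_tail ?powR_gt0// -EFinM -powRrM mulrN mulVf ?gt_eqF//.
rewrite powR_inv1 ?ltW//; congr (_%:E).
by field; rewrite !gt_eqF.
Qed.

(** Polar coordinates in disguise: the indicator of the finite part of the
    superlevel set is written as the moment times its own inverse, and the order of
    integration is exchanged after the substitution [y = t xi]. The factor
    [1 / (n K)] is the integral of [t ^ (- n - 1)] over the part of the ray
    where the moment is at least [K]. *)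
Lemma volume_finite (K : R) : (0 < K)%R ->
  mu [set xi | K%:E <= ray_moment N xi < +oo] =
  ((N * K)^-1)%:E * \int[mu]_y (g y * \1_[set xi | (ray_moment N xi < +oo)%E] y)%:E.
Proof.
move=> K0; set W := [set xi | _].
have mnu := measurable_ray_moment N.
set D := [set xi | ray_moment N xi < +oo].
have mD : measurable D.
  by rewrite -[X in measurable X]setTI; exact: measurable_lte.
have mW : measurable W.
  rewrite (_ : W = D `&` ~` (setT `&` [set xi | ray_moment N xi < K%:E])); last first.
    rewrite !setTI; apply/seteqP; split => x /=.
      by move=> /andP[Kx xoo]; split => //; apply/negP; rewrite -leNgt.
    by move=> [Dx /negP]; rewrite -leNgt => Kx; apply/andP.
  apply: measurableI => //.
  by apply: measurableC; exact: measurable_lte.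
pose w xi : R := (fine (ray_moment N xi) `^ (- 1) * \1_W xi)%R.
have w0 xi : (0 <= w xi)%R by rewrite mulr_ge0 ?powR_ge0// indicE.
have mw : measurable_fun setT w.
  apply: measurable_funM; last exact: measurable_indic.
  apply: (measurableT_comp (measurable_powR _)).
  by apply: measurableT_comp.
have nuW xi : W xi -> exists2 v : R, (0 < v)%R & ray_moment N xi = v%:E.
  move=> /andP[Kx xoo].
  have xfin : ray_moment N xi \is a fin_num.
    by rewrite ge0_fin_numE// ray_moment_ge0.
  exists (fine (ray_moment N xi)); last by rewrite fineK.
  by rewrite -lte_fin fineK// (lt_le_trans _ Kx)// lte_fin.
have wE xi : (\1_W xi : R)%:E = (w xi)%:E * ray_moment N xi.
  rewrite /w indicE; have [xW|_] /= := boolP (xi \in W).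
    have [v v0 ->] := nuW _ (set_mem xW).
    by rewrite /= mulr1 powR_inv1 ?(ltW v0)// -EFinM mulVf ?gt_eqF.
  by rewrite mulr0 mul0e.
pose J (z : V * T) : \bar R :=
  (w z.1 * (z.2 `^ (N - 1) * g (z.2 *: z.1) * \1_pos z.2))%:E.
have mJ : measurable_fun setT J.
  apply/measurable_EFinP; apply: measurable_funM.
    by apply: measurableT_comp => //; exact: measurable_fst.
  apply: measurable_funM => //.
  by apply: measurable_funM; [exact: mpowT|exact: measurable_scaled].
have J0 z : 0 <= J z by rewrite lee_fin !mulr_ge0 ?powR_ge0// indicE.
pose J' (z : V * T) : \bar R :=
  (g z.1 * (w (z.2 `^ (- 1) *: z.1) * z.2 `^ (- 1) * \1_pos z.2))%:E.
have mw' : measurable_fun setT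
    (fun z : V * T => w (z.2 `^ (- 1) *: z.1) * z.2 `^ (- 1) * \1_pos z.2)%R.
  apply: measurable_funM => //; apply: measurable_funM; last exact: mpowT.
  apply: measurableT_comp => //; apply: measurable_fun_rV => i.
  under eq_fun do rewrite mxE.
  apply: measurable_funM; first exact: mpowT.
  by apply: (measurableT_comp (measurable_coord i)); exact: measurable_fst.
have mJ' : measurable_fun setT J'.
  apply/measurable_EFinP; apply: measurable_funM => //.
  by apply: measurableT_comp => //; exact: measurable_fst.
have J'0 z : 0 <= J' z by rewrite lee_fin !mulr_ge0 ?powR_ge0// indicE.
have -> : mu W = \int[mu]_xi \int[leb]_t J (xi, t).
  rewrite -[in LHS](setIT W) -integral_indic//; apply: eq_integral => xi _.
  rewrite wE momentE -ge0_integralZl_EFin//.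
  - by move=> t _; rewrite lee_fin !mulr_ge0 ?powR_ge0// indicE.
  - apply/measurable_EFinP; apply: measurable_funM; last first.
      by apply: measurable_indic; exact: measurable_itv.
    by apply: measurable_funM; [exact: measurable_powR|exact: measurable_ray].
rewrite (@fubini_tonelli _ _ _ _ _ mu leb J mJ J0).
have -> : \int[leb]_t \int[mu]_xi J (xi, t) = \int[leb]_t \int[mu]_y J' (y, t).
  apply: eq_integral => t _.
  have [t0|t0] := ltP 0%R t; last first.
    by rewrite !integral0_eq// => y _; rewrite /J/J'/= indicE /pos mem_setE
      in_itv/= ltNge t0/= !mulr0.
  have tV0 : (t^-1 != 0)%R by rewrite invr_eq0 gt_eqF.
  have mJt := measurable_fun_pair1 t mJ.
  have := integral_rV_affine 0%R tV0 mJt (fun y => J0 (y, t)).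
  rewrite gtr0_norm ?invr_gt0// -exprVn invrK.
  move=> /(congr1 (fun z => (t ^- n)%:E * z)); rewrite muleA -EFinM mulVf; last first.
    by rewrite expf_eq0 (gt_eqF t0) andbF.
  rewrite mul1e => <-; rewrite -ge0_integralZl_EFin//; last 2 first.
  - have := measurableT_comp mJt (measurable_affine t^-1 0%R).
    exact.
  - by rewrite invr_ge0 exprn_ge0// ltW.
  apply: eq_integral => y _; rewrite /J /J'/= addr0 -EFinM; congr (_%:E).
  rewrite scalerA mulfV ?gt_eqF// scale1r powR_inv1 ?(ltW t0)//.
  have -> : (t `^ (N - 1) = t ^+ n / t)%R.
    by rewrite -powR_mulrn ?(ltW t0)// powRB ?powRr1 ?(ltW t0)// (gt_eqF t0) implybT.
  have t_neq0 : (t != 0)%R by rewrite gt_eqF.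
  have tn_neq0 : (t ^+ n != 0)%R by rewrite expf_neq0.
  move: (t ^+ n)%R tn_neq0 (w _) => c c_neq0 wt.
  by field; rewrite c_neq0 t_neq0.
rewrite -(@fubini_tonelli _ _ _ _ _ mu leb J' mJ' J'0).
rewrite -ge0_integralZl_EFin//; last 3 first.
- by move=> y _; rewrite lee_fin mulr_ge0// indicE.
- by apply/measurable_EFinP; apply: measurable_funM => //; exact: measurable_indic.
- by rewrite invr_ge0 mulr_ge0 ?(ltW N0) ?(ltW K0).
apply: eq_integral => y _; rewrite /J'/=.
under eq_integral do rewrite EFinM.
rewrite ge0_integralZl_EFin//; last 2 first.
- by move=> t _; rewrite lee_fin !mulr_ge0 ?powR_ge0// indicE.
- have mJy := measurable_fun_pair2 y mw'.
  by apply/measurable_EFinP; exact: mJy.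
rewrite EFinM muleCA.
have [nu0|nu_neq0] := eqVneq (ray_moment N y) 0.
  by rewrite (ray_moment_eq0 N0 nu0) !mul0e.
congr (_ * _).
have nuZ (t : R) : (0 < t)%R ->
    ray_moment N (t `^ (- 1) *: y)%R = (t `^ N)%:E * ray_moment N y.
  by move=> t0; rewrite ray_momentZ ?powR_gt0// -powRrM mulrNN mul1r.
have [nuoo|nu_fin] := eqVneq (ray_moment N y) +oo.
  rewrite [in RHS]indicE memNset ?mule0; last by rewrite /D/= nuoo ltxx.
  apply: integral0_eq => t _; rewrite /w [in X in X%:E]/=.
  rewrite [\1_pos t]indicE /pos mem_setE in_itv/= andbT.
  case: ltP => [t0|_]; last by rewrite mulr0.
  rewrite indicE memNset ?mulr0 ?mul0r// /W/= nuZ// nuoo gt0_muley ?ltxx ?andbF//.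
  by rewrite lte_fin powR_gt0.
have nu_ge0 := ray_moment_ge0 N y.
have {}nu_fin : ray_moment N y \is a fin_num.
  by rewrite ge0_fin_numE// lt_neqAle nu_fin leey.
rewrite [in RHS]indicE mem_set ?mule1; last by rewrite /D/= -ge0_fin_numE.
pose v := fine (ray_moment N y).
have nuE : ray_moment N y = v%:E by rewrite /v fineK.
have v0 : (0 < v)%R by rewrite -lte_fin -nuE lt_neqAle eq_sym nu_neq0.
rewrite -(inner_integral K0 v0) [RHS]integral_mkcond; apply: eq_integral => t _.
rewrite patchE mem_setE in_itv/= andbT [\1_pos t]indicE /pos mem_setE in_itv/= andbT.
have tau0 : (0 < (K / v) `^ N^-1)%R by rewrite powR_gt0 ?divr_gt0.
have [t0|t0] := ltP 0%R t; last first.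
  by rewrite mulr0 leNgt (le_lt_trans t0 tau0).
have tauE : ((K / v) `^ N^-1 <= t)%R = (K <= t `^ N * v)%R.
  rewrite -ler_pdivrMr//; apply/idP/idP => Kt.
    have -> : (K / v = ((K / v) `^ N^-1) `^ N)%R.
      by rewrite -powRrM mulVf ?gt_eqF// powRr1// divr_ge0 ?ltW.
    by apply: ge0_ler_powR; rewrite ?nnegrE ?(ltW N0) ?(ltW tau0) ?(ltW t0).
  have -> : (t = (t `^ N) `^ N^-1)%R.
    by rewrite -powRrM mulfV ?gt_eqF// powRr1// ltW.
  by apply: ge0_ler_powR; rewrite ?nnegrE ?invr_ge0 ?powR_ge0 ?(ltW N0)// divr_ge0 ?ltW.
rewrite mulr1 /w nuZ// nuE -EFinM/= tauE indicE.
have [Kt|Kt] := leP K (t `^ N * v)%R; last first.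
  by rewrite memNset ?mulr0 ?mul0r// /W/= nuZ// nuE -EFinM lee_fin leNgt Kt.
rewrite mem_set /W/= ?nuZ// ?nuE -?EFinM ?lee_fin ?ltry ?Kt// mulr1.
congr (_%:E); rewrite powRM ?powR_ge0 ?(ltW v0)// -powRrM mulrN1 powR_inv1 ?(ltW v0)//.
rewrite mulrAC -powRD; last by rewrite (gt_eqF t0) implybT.
by rewrite mulrC.
Qed.

(** On the rays of infinite moment [g] is constant and positive. They form a cone,
    of measure [0] or [+oo]; in the latter case both sides are infinite. *)
Theorem volume_superlevel (K : R) : (0 < K)%R ->
  mu [set xi | K%:E <= ray_moment N xi] =
  ((N * K)^-1)%:E * \int[mu]_y (g y)%:E.
Proof.
move=> K0; have NK0 : (0 < (N * K)^-1)%R by rewrite invr_gt0 mulr_gt0.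
have mnu := measurable_ray_moment N.
set A := [set xi | ray_moment N xi = +oo].
have mA : measurable A.
  by have := mnu measurableT _ (emeasurable_set1 +oo); rewrite setTI.
have mS : measurable [set xi | K%:E <= ray_moment N xi].
  have -> : [set xi | K%:E <= ray_moment N xi] =
      ~` (setT `&` [set xi | ray_moment N xi < K%:E]).
    rewrite setTI; apply/seteqP; split => x /=.
      by rewrite leNgt => /negP.
    by move=> /negP; rewrite -leNgt.
  by apply: measurableC; exact: measurable_lte.
have [A0|Aoo] := ray_moment_infty_measure N; last first.
  have -> : mu [set xi | K%:E <= ray_moment N xi] = +oo.
    apply/eqP; rewrite -leye_eq -Aoo; apply: le_measure; rewrite ?inE//.
    by move=> x; rewrite /A/= => ->; exact: leey.
  suff -> : \int[mu]_y (g y)%:E = +oo by rewrite gt0_muley// lte_fin.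
  apply/eqP; rewrite -leye_eq.
  have <- : (g 0)%:E * mu A = +oo by rewrite Aoo gt0_muley// lte_fin.
  rewrite -integral_cst// integral_mkcond; apply: ge0_le_integral_gen => y.
    by rewrite patchE; case: ifPn => // _; rewrite lee_fin.
  rewrite patchE; case: ifPn => [/set_mem yA|_]; last by rewrite lee_fin.
  by rewrite (ray_moment_infty N0 yA).
have -> : \int[mu]_y (g y)%:E =
    \int[mu]_y (g y * \1_[set xi | (ray_moment N xi < +oo)%E] y)%:E.
  apply: ae_eq_integral_gen.
  - by move=> y; rewrite lee_fin.
  - by move=> y; rewrite lee_fin mulr_ge0// indicE.
  exists A; split => // y /= gy; apply: contrapT => Ay; apply: gy.
  by rewrite indicE mem_set ?mulr1//= lt_neqAle leey andbT; apply/eqP.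
rewrite -volume_finite//.
set W := [set xi | K%:E <= ray_moment N xi < +oo].
have -> : W = [set xi | K%:E <= ray_moment N xi] `\` A.
  apply/seteqP; split => x.
    by move=> /andP[Kx xoo]; split => // xA; move: xoo; rewrite xA ltxx.
  by move=> [Kx xA]; apply/andP; split => //; rewrite lt_neqAle leey andbT; apply/eqP.
rewrite [LHS](measureDI _ mS mA) [X in _ + X](_ : _ = 0) ?adde0//.
apply/eqP; rewrite -measure_le0 -A0.
by apply: le_measure; rewrite ?inE//; exact: measurableI.
Qed.

End volume.

(** * The Hölder inequalities *)

Section powere_theory.
Context {R : realType}.
Local Open Scope ereal_scope.
Implicit Types (x r p : R).

Lemma powere_ge0 (x : \bar R) r : 0 <= powere x r.
Proof.
by rewrite /powere; case: ifPn => _; rewrite ?inve_ge0 poweR_ge0.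
Qed.

Lemma powere_pos (x : \bar R) r : (0 <= r)%R -> powere x r = x `^ r.
Proof. by rewrite /powere leNgt => /negbTE ->. Qed.

Lemma powere_EFin x r : (0 < x)%R -> powere x%:E r = (x `^ r)%:E.
Proof.
move=> x0; rewrite /powere; case: ifPn => // _.
rewrite poweR_EFin inver powRN invrK; case: ifPn => // /eqP.
by move=> /eqP; rewrite invr_eq0 powR_eq0 (gt_eqF x0).
Qed.

Lemma powere0 r : (r < 0)%R -> powere 0%:E r = +oo :> \bar R.
Proof.
by move=> r0; rewrite /powere r0 poweR0r ?oppr_eq0 ?lt_eqF// inve0.
Qed.

Lemma powere_poweR x r p : (0 <= x)%R -> (0 < p)%R ->
  powere x%:E r `^ p = powere x%:E (r * p).
Proof.
move=> x0 p0; have [r0|r0] := leP 0%R r.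
  by rewrite !powere_pos ?mulr_ge0 ?(ltW p0)// poweRrM.
have rp0 : (r * p < 0)%R by rewrite nmulr_rlt0.
move: x0; rewrite le_eqVlt => /predU1P[<-|x0].
  by rewrite !powere0// poweRyr// gt_eqF.
by rewrite !powere_EFin// poweR_EFin powRrM.
Qed.

End powere_theory.

Section hoelder_correlation.
Context d {T : measurableType d} {R : realType}.
Variable mu : {measure set T -> \bar R}.
Local Open Scope ereal_scope.
Implicit Types (u v : T -> R).

Lemma hoelder_geometric (a : R) u v : (0 < a < 1)%R ->
  measurable_fun setT u -> measurable_fun setT v ->
  (forall x, 0 <= u x)%R -> (forall x, 0 <= v x)%R ->
  \int[mu]_x (u x `^ a * v x `^ (1 - a))%:E <=
  (\int[mu]_x (u x)%:E) `^ a * (\int[mu]_x (v x)%:E) `^ (1 - a).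
Proof.
move=> /andP[a0 a1] mu_ mv u0 v0; have a'0 : (0 < 1 - a)%R by rewrite subr_gt0.
have mpow w (r : R) : measurable_fun setT w ->
    measurable_fun setT (fun x : T => w x `^ r)%R.
  by move=> mw; apply: (measurableT_comp (measurable_powR r)).
have norm w (r : R) : (0 < r)%R -> (forall x, 0 <= w x)%R ->
    'N[mu]_(r^-1)%:E[EFin \o (fun x => w x `^ r)%R] = (\int[mu]_x (w x)%:E) `^ r.
  move=> r0 w0; rewrite unlock invrK; congr (_ `^ _).
  apply: eq_integral => x _; rewrite /= ger0_norm ?powR_ge0// -powRrM.
  by rewrite mulfV ?gt_eqF// powRr1.
rewrite -!norm//; have := @hoelder _ T R mu (fun x => u x `^ a)%R
  (fun x => v x `^ (1 - a))%R a^-1 (1 - a)^-1.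
rewrite !invr_gt0 !invrK Lnorm1 => /(_ (mpow _ _ mu_) (mpow _ _ mv) a0 a'0).
rewrite subrKC => /(_ erefl); apply: le_trans.
rewrite le_eqVlt; apply/orP; left; apply/eqP.
by apply: eq_integral => x _; rewrite /= ger0_norm// mulr_ge0 ?powR_ge0.
Qed.

Definition mixed_integral (r : R) u v : \bar R :=
  \int[mu]_x ((u x)%:E * powere (v x)%:E r).

Lemma mixed_integral_ge0 (r : R) u v : (forall x, 0 <= u x)%R ->
  0 <= mixed_integral r u v.
Proof.
by move=> u0; apply: integral_ge0 => x _; rewrite mule_ge0 ?lee_fin ?powere_ge0.
Qed.

Lemma Lnorm_mixed (p r : R) u v : (0 < p)%R ->
  (forall x, 0 <= u x)%R -> (forall x, 0 <= v x)%R ->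
  'N[mu]_p%:E[(fun x => powere (u x)%:E p^-1 * powere (v x)%:E r)] =
  mixed_integral (r * p) u v `^ p^-1.
Proof.
move=> p0 u0 v0; rewrite unlock; congr (_ `^ _); apply: eq_integral => x _.
rewrite gee0_abs ?mule_ge0 ?powere_ge0// poweRM ?powere_ge0//.
rewrite !powere_poweR// mulVf ?gt_eqF// [in LHS]powere_pos ?ler01//.
by rewrite poweRe1 ?lee_fin.
Qed.

Lemma mixed_integral_le (r : R) u v : (0 < r < 1)%R ->
  measurable_fun setT u -> measurable_fun setT v ->
  (forall x, 0 <= u x)%R -> (forall x, 0 <= v x)%R ->
  mixed_integral r u v <=
  (\int[mu]_x (u x)%:E) `^ (1 - r) * (\int[mu]_x (u x * v x)%:E) `^ r.
Proof.
move=> /andP[r0 r1] mu_ mv u0 v0.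
have r01 : (0 < 1 - r < 1)%R by rewrite subr_gt0 r1 ltrBlDr ltrDl.
have := hoelder_geometric r01 mu_ (measurable_funM mu_ mv) u0
  (fun x => mulr_ge0 (u0 x) (v0 x)).
rewrite opprB addrCA subrr addr0; apply: le_trans.
rewrite le_eqVlt; apply/orP; left; apply/eqP.
apply: eq_integral => x _; rewrite powere_pos ?(ltW r0)// poweR_EFin -EFinM.
congr (_%:E); rewrite powRM// mulrA; congr (_ * _)%R.
have [->|ux] := eqVneq (u x) 0%R; first by rewrite powR0 ?mul0r ?gt_eqF ?subr_gt0.
by rewrite -powRD ?subrK ?powRr1// ux implybT.
Qed.

(** Where [v] vanishes and [u] does not, the integrand on the left is infinite;
    so either the integral is infinite or this set is negligible and Hölder's
    inequality applies to [u = (u v ^ r) ^ a (u v) ^ (1 - a)]. *)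
Lemma mixed_integral_ge (a r : R) u v : (0 < a < 1)%R -> (r = 1 - a^-1)%R ->
  measurable_fun setT u -> measurable_fun setT v ->
  (forall x, 0 <= u x)%R -> (forall x, 0 <= v x)%R ->
  mixed_integral r u v < +oo ->
  \int[mu]_x (u x)%:E <=
  mixed_integral r u v `^ a * (\int[mu]_x (u x * v x)%:E) `^ (1 - a).
Proof.
move=> a01 rE mu_ mv u0 v0 finM; have /andP[a0 a1] := a01.
have r0 : (r < 0)%R by rewrite rE subr_lt0 invf_gt1.
pose Z := [set x | (0 < u x)%R /\ v x = 0%R].
have mZ : measurable Z.
  rewrite (_ : Z = [set x | (0 < u x)%R] `&` [set x | (v x <= 0)%R]).
    apply: measurableI.
      have := mu_ measurableT _ (measurable_itv `]0%R, +oo[); rewrite setTI.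
      by congr (measurable _); apply/seteqP; split => x; rewrite /= in_itv/= andbT.
    have := mv measurableT _ (measurable_itv `]-oo, 0%R]); rewrite setTI.
    by congr (measurable _); apply/seteqP; split => x; rewrite /= in_itv/=.
  apply/seteqP; split => x /= [ux vx]; split => //; first by rewrite vx.
  by apply/eqP; rewrite eq_le vx v0.
have Z0 : mu Z = 0.
  apply: contrapT => /eqP Z_neq0.
  have Zgt0 : 0 < mu Z by rewrite lt_neqAle eq_sym Z_neq0 measure_ge0.
  suff : +oo <= mixed_integral r u v by rewrite leNgt finM.
  have <- : \int[mu]_(x in Z) (cst +oo x) = +oo :> \bar R.
    by rewrite integral_cst// gt0_mulye.
  rewrite integral_mkcond; apply: ge0_le_integral_gen => x; rewrite patchE.
    by case: ifPn => // _; exact: leey.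
  case: ifPn => [/set_mem[ux vx]|_]; last by rewrite mule_ge0 ?lee_fin ?powere_ge0.
  by rewrite vx powere0// gt0_muley.
pose w x := (u x * v x `^ r)%R.
have w0 x : (0 <= w x)%R by rewrite mulr_ge0 ?powR_ge0.
have mw : measurable_fun setT w.
  by apply: measurable_funM => //; apply: (measurableT_comp (measurable_powR r)).
have wM : \int[mu]_x (w x)%:E <= mixed_integral r u v.
  apply: ge0_le_integral_gen => x; first by rewrite lee_fin.
  rewrite /w; have := v0 x; rewrite le_eqVlt => /predU1P[<-|vx].
    by rewrite powR0 ?lt_eqF// mulr0 mule_ge0 ?lee_fin ?powere_ge0.
  by rewrite powere_EFin// EFinM.
apply: (@le_trans _ _ (\int[mu]_x (w x `^ a * (u x * v x) `^ (1 - a))%:E)).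
  apply: ae_le_integral_gen.
  - by move=> x; rewrite lee_fin.
  - by move=> x; rewrite lee_fin mulr_ge0 ?powR_ge0.
  exists Z; split => // x /= uw; apply: contrapT => Zx; apply: uw.
  rewrite lee_fin; have := u0 x; rewrite le_eqVlt => /predU1P[ux|ux].
    by rewrite -ux mulr_ge0 ?powR_ge0.
  have vx : (0 < v x)%R.
    by rewrite lt_neqAle v0 andbT; apply/eqP => vx; apply: Zx.
  rewrite /w !powRM ?powR_ge0// mulrACA -powRD ?(gt_eqF ux) ?implybT//.
  rewrite subrKC powRr1// -powRrM -powRD ?(gt_eqF vx) ?implybT//.
  rewrite (_ : r * a + (1 - a) = 0)%R ?powRr0 ?mulr1//.
  by rewrite rE mulrBl mul1r mulVf ?gt_eqF//; ring.
apply: le_trans (hoelder_geometric a01 mw (measurable_funM mu_ mv) w0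
  (fun x => mulr_ge0 (u0 x) (v0 x))) _.
rewrite lee_wpmul2r ?poweR_ge0//.
apply: gt0_ler_poweR => //; rewrite ?in_itv/= ?leey ?andbT.
- exact: ltW.
- by apply: integral_ge0 => x _; rewrite lee_fin.
- exact: mixed_integral_ge0.
Qed.

End hoelder_correlation.

(** * Correlation of even functions *)

Section correlation_even.
Context {R : realType} {n : nat}.
Local Open Scope ereal_scope.
Local Notation mu := (@lebesgue_rV R n).
Local Notation V := 'rV[R]_n.
Local Notation N := (n%:R : R).
Variables (s : R) (f h : V -> R).
Hypotheses (n_gt0 : (0 < n)%N) (s_gt0 : (0 < s)%R).
Hypotheses (f_ge0 : forall x, (0 <= f x)%R) (h_ge0 : forall x, (0 <= h x)%R).
Hypotheses (f_L2 : square_integrable f) (h_L2 : square_integrable h).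
Hypotheses (f_even : even_fun f) (h_even : even_fun h).
Hypotheses (f_conc : s_concave_on_support s f).
Hypotheses (h_conc : s_concave_on_support s h).

Let k : R := (N + 2 / s)%R.

Let k0 : (0 < k)%R. Proof. by rewrite addr_gt0 ?ltr0n ?divr_gt0. Qed.

Let fM x : (0 <= f x <= f 0)%R.
Proof. by rewrite f_ge0 (even_s_concave_le0 _ s_gt0). Qed.

Let hM x : (0 <= h x <= h 0)%R.
Proof. by rewrite h_ge0 (even_s_concave_le0 _ s_gt0). Qed.

Let borel_version u (M : R) : (forall x, 0 <= u x <= M)%R ->
  square_integrable u -> exists u1 : V -> R, [/\ measurable_fun setT u1,
    (forall x, 0 <= u1 x)%R, {ae mu, forall x, u x = u1 x} &
    \int[mu]_x ((u1 x) ^+ 2)%:E < +oo].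
Proof.
move=> uM uL; have [u1 [u2 [m1 _ B e12 L1]]] := square_integrable_squeeze uM uL.
exists u1; split => //; first by move=> x; have [] := B x.
apply: filterS e12 => x e; have [_ [u1u uu2]] := B x.
by apply/eqP; rewrite eq_le u1u e uu2.
Qed.

Lemma corr_lty y : corr f h y < +oo.
Proof.
have [f1 [mf1 f10 ff1 f12]] := borel_version fM f_L2.
have [h1 [mh1 h10 hh1 h12]] := borel_version hM h_L2.
by rewrite (eq_corr y f_ge0 h_ge0 f10 h10 ff1 hh1) corr_L2_lty.
Qed.

Definition fcorr (y : V) : R := fine (corr f h y).

Lemma fcorrE y : (fcorr y)%:E = corr f h y.
Proof. by rewrite fineK// ge0_fin_numE ?corr_lty// corr_ge0. Qed.

Lemma fcorr_ge0 y : (0 <= fcorr y)%R.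
Proof. by rewrite fine_ge0// corr_ge0. Qed.

Lemma measurable_fcorr : measurable_fun setT fcorr.
Proof.
have [f1 [mf1 f10 ff1 _]] := borel_version fM f_L2.
have [h1 [mh1 h10 hh1 _]] := borel_version hM h_L2.
have -> : fcorr = fine \o corr f1 h1.
  by apply/funext => y; rewrite /fcorr (eq_corr y f_ge0 h_ge0 f10 h10 ff1 hh1).
by apply: measurableT_comp => //; exact: measurable_corr.
Qed.

Lemma integral_fcorr : \int[mu]_y (fcorr y)%:E =
  \int[mu]_x (f x)%:E * \int[mu]_x (h x)%:E.
Proof.
have [f1 [mf1 f10 ff1 _]] := borel_version fM f_L2.
have [h1 [mh1 h10 hh1 _]] := borel_version hM h_L2.
under eq_integral do rewrite fcorrE (eq_corr _ f_ge0 h_ge0 f10 h10 ff1 hh1).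
rewrite integral_corr//; congr (_ * _); apply: ae_eq_integral_gen.
- by move=> x; rewrite lee_fin.
- by move=> x; rewrite lee_fin.
- by apply: filterS ff1 => x ->.
- by move=> x; rewrite lee_fin.
- by move=> x; rewrite lee_fin.
- by apply: filterS hh1 => x ->.
Qed.

Lemma fcorrN y : fcorr (- y) = fcorr y.
Proof.
have [f1 [mf1 f10 ff1 _]] := borel_version fM f_L2.
have [h1 [mh1 h10 hh1 _]] := borel_version hM h_L2.
rewrite /fcorr (eq_corr _ f_ge0 h_ge0 f10 h10 ff1 hh1) corrN//; congr fine.
have m1 : (-1 != 0 :> R)%R by rewrite oppr_eq0 oner_neq0.
have reflect u u1 : even_fun u -> {ae mu, forall x, u x = u1 x} ->
    {ae mu, forall x, (u1 \o -%R) x = u x}.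
  move=> uE /(ae_lebesgue_rV_affine 0%R m1); apply: filterS => x.
  by rewrite addr0 scaleN1r uE.
by apply: eq_corr => //; [move=> x; exact: f10|move=> x; exact: h10|
  exact: reflect|exact: reflect].
Qed.

Let fcorr_dominates (l : R) (y0 y1 : V) (a b : R) : (0 < l < 1)%R ->
  (0 < a < fcorr y0)%R -> (0 < b < fcorr y1)%R ->
  (pmean k^-1 l a b <= fcorr ((1 - l) *: y0 + l *: y1))%R.
Proof.
move=> l01 /andP[a0 ay] /andP[b0 b_y]; rewrite -lee_fin fcorrE.
have dom : dominates_pmean k^-1 l (corr f h y0) (corr f h y1)
    (corr f h ((1 - l) *: y0 + l *: y1)%R) by exact: corr_concave.
apply: dom => //.
- by rewrite -fcorrE lte_fin.
- by rewrite -fcorrE lte_fin.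
Qed.

Lemma fcorr_le0 y : (fcorr y <= fcorr 0)%R.
Proof.
rewrite leNgt; apply/negP => gy.
pose a : R := ((fcorr y + fcorr 0) / 2)%R.
have g0 := fcorr_ge0 0.
have ay : (0 < a < fcorr y)%R by rewrite /a; apply/andP; split; lra.
have ay' : (0 < a < fcorr (- y)%R)%R by rewrite fcorrN.
have l01 : (0 < (2^-1 : R) < 1)%R by apply/andP; split; lra.
have := fcorr_dominates l01 ay ay'.
rewrite pmean_id ?invr_eq0 ?gt_eqF//; last by have /andP[/ltW] := ay.
rewrite scalerN -scalerBl (_ : 1 - 2^-1 - 2^-1 = 0)%R ?scale0r; last by lra.
by rewrite /a; lra.
Qed.

Lemma fcorr_conc (y : V) (l : R) : (0 < l < 1)%R -> (0 < fcorr y)%R ->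
  (pmean k^-1 l (fcorr 0) (fcorr y) <= fcorr (l *: y))%R.
Proof.
move=> l01 gy; have g0 : (0 < fcorr 0)%R := lt_le_trans gy (fcorr_le0 y).
have /andP[l0 l1] := l01.
set M := pmean _ _ _ _; have M0 : (0 < M)%R by exact: pmean_gt0.
(* The domination concerns values strictly below those of [fcorr]: both are
   multiplied by a factor [r < 1] close enough to [1] to keep the contradiction. *)
rewrite leNgt; apply/negP => lt_M.
pose r : R := ((fcorr (l *: y) / M + 1) / 2)%R.
have rM : (fcorr (l *: y) / M < 1)%R by rewrite ltr_pdivrMr// mul1r.
have r0 : (0 <= fcorr (l *: y) / M)%R by rewrite divr_ge0 ?fcorr_ge0 ?(ltW M0).
have r01 : (0 < r < 1)%R by rewrite /r; apply/andP; split; lra.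
have /andP[r_gt0 r1] := r01.
have scaled x : (0 < x)%R -> (0 < r * x < x)%R.
  by move=> x0; rewrite mulr_gt0//= gtr_pMl.
have := fcorr_dominates l01 (scaled _ g0) (scaled _ gy).
rewrite scaler0 add0r pmeanZ ?invr_eq0 ?gt_eqF ?(ltW l0) ?(ltW l1) ?(ltW r_gt0)
  ?fcorr_ge0//.
rewrite -/M -ler_pdivlMr// /r; lra.
Qed.

Lemma radial_moment_corr (a : R) xi : radial_moment a f h xi = ray_moment fcorr a xi.
Proof.
rewrite /radial_moment /ray_moment /moment; apply: eq_integral => t _.
by rewrite fcorrE.
Qed.

Let set0_box : [set 0%R : V] =
  [set v : V | forall i, [set 0%R : R] (v ord0 i)].
Proof.
apply/seteqP; split => [v -> i|v v0]; first by rewrite /= mxE.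
by apply/rowP => i; rewrite mxE; exact: v0.
Qed.

Lemma measurable_rV_set0 : measurable [set 0%R : V].
Proof.
rewrite set0_box; apply: (@measurable_rV_box R n (fun=> [set 0%R])) => i.
exact: measurable_set1.
Qed.

Lemma lebesgue_rV_set0 : mu [set 0%R] = 0.
Proof.
rewrite set0_box (@lebesgue_rV_box R n (fun=> [set 0%R])); last first.
  by move=> i; exact: measurable_set1.
rewrite (bigD1 (Ordinal n_gt0))//= [X in X * _](_ : _ = 0) ?mul0e//.
exact: lebesgue_measure_set1.
Qed.

Section positive.
Hypothesis G0 : (0 < fcorr 0)%R.
Let G := fcorr 0.
Let B (a : R) := beta a (k + 1).

Let N0 : (0 < N)%R. Proof. by rewrite ltr0n. Qed.

(** The radius at which the tent function of height [G] has [alpha]-th moment [1]. *)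
Let radius (alpha : R) : R := ((G * B alpha)^-1 `^ alpha^-1)%R.
Let level (alpha : R) : R := (G * (radius alpha `^ N * B N))%R.

Let B_gt0 (a : R) : (0 < a)%R -> (0 < B a)%R.
Proof. by move=> a0; exact: beta_gt0. Qed.

Let GB_gt0 (a : R) : (0 < a)%R -> (0 < G * B a)%R.
Proof. by move=> a0; rewrite mulr_gt0 ?B_gt0. Qed.

Let radius_gt0 (alpha : R) : (0 < alpha)%R -> (0 < radius alpha)%R.
Proof. by move=> a0; rewrite powR_gt0// invr_gt0 GB_gt0. Qed.

Let level_gt0 (alpha : R) : (0 < alpha)%R -> (0 < level alpha)%R.
Proof.
move=> a0; apply: mulr_gt0 => //; apply: mulr_gt0; last exact: B_gt0.
by apply: powR_gt0; exact: radius_gt0.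
Qed.

Let radiusE (alpha : R) : (0 < alpha)%R -> (G * (radius alpha `^ alpha * B alpha) = 1)%R.
Proof.
move=> a0; rewrite -powRrM mulVf ?gt_eqF// powRr1 ?invr_ge0 ?(ltW (GB_gt0 a0))//.
by rewrite mulrCA mulVf// gt_eqF ?GB_gt0.
Qed.

Let ray_berwald (a b r : R) xi : (0 < a)%R -> (a < b)%R -> (0 < r)%R ->
  (G * (r `^ b * B b))%:E <= ray_moment fcorr b xi ->
  (G * (r `^ a * B a))%:E <= ray_moment fcorr a xi.
Proof.
apply: berwald_level => //.
- exact: measurable_ray measurable_fcorr xi.
- by move=> t; exact: fcorr_ge0.
- by move=> t l t0 l01 gt0; rewrite -scalerA; exact: fcorr_conc.
Qed.

Let measurable_level (a c : R) : measurable [set xi | c%:E <= ray_moment fcorr a xi].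
Proof.
have m := measurable_ray_moment measurable_fcorr fcorr_ge0 a.
rewrite (_ : [set _ | _] = ~` (setT `&` [set xi | ray_moment fcorr a xi < c%:E])).
  by apply: measurableC; exact: measurable_lte.
rewrite setTI; apply/seteqP; split => x /=; first by rewrite leNgt => /negP.
by move=> /negP; rewrite -leNgt.
Qed.

Let starE (alpha : R) : star_moment alpha f h =
  [set 0%R] `|` [set xi | 1 <= ray_moment fcorr alpha xi].
Proof.
by apply/seteqP; split => xi; rewrite /star_moment /= radial_moment_corr.
Qed.

Let level_measure (alpha : R) : (0 < alpha)%R ->
  mu [set xi | (level alpha)%:E <= ray_moment fcorr N xi] =
  ((N * level alpha)^-1)%:E * (\int[mu]_x (f x)%:E * \int[mu]_x (h x)%:E).
Proof.
move=> a0; rewrite -integral_fcorr.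
exact: (volume_superlevel n_gt0 k0 measurable_fcorr fcorr_ge0 G0 fcorr_le0
  fcorr_conc (level_gt0 a0)).
Qed.

(** By Berwald's inequality the [alpha]-th moment is at least [1] wherever the
    [n]-th one reaches its level. *)
Lemma star_volume_ge (alpha : R) : (0 < alpha)%R -> (alpha < N)%R ->
  ((N * level alpha)^-1)%:E * (\int[mu]_x (f x)%:E * \int[mu]_x (h x)%:E) <=
  mu (star_moment alpha f h).
Proof.
move=> a0 aN; rewrite -level_measure// starE; apply: le_measure; rewrite ?inE.
- exact: measurable_level.
- by apply: measurableU; [exact: measurable_rV_set0|exact: measurable_level].
move=> xi /(ray_berwald a0 aN (radius_gt0 a0)); rewrite radiusE// => ?.
by right.
Qed.

Lemma star_volume_le (alpha : R) : (N < alpha)%R ->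
  mu (star_moment alpha f h) <=
  ((N * level alpha)^-1)%:E * (\int[mu]_x (f x)%:E * \int[mu]_x (h x)%:E).
Proof.
move=> aN; have a0 := lt_trans N0 aN; rewrite -level_measure// starE.
apply: le_trans (measureU2 _ measurable_rV_set0 (measurable_level _ _)) _.
rewrite [X in X + _]lebesgue_rV_set0 add0e; apply: le_measure; rewrite ?inE;
  [exact: measurable_level|exact: measurable_level|].
by move=> xi xiS; apply: (ray_berwald N0 aN (radius_gt0 a0)); rewrite radiusE.
Qed.

(** The constant in front of the volume undoes the normalization of the level. *)
Lemma level_normalization (alpha : R) : (0 < alpha)%R ->
  ((N * B N) `^ (alpha / N) / B alpha * (N * level alpha)^-1 `^ (alpha / N) =
   G `^ (1 - alpha / N))%R.
Proof.
move=> a0; have B0 := B_gt0 a0; have BN0 := B_gt0 N0; have r0 := radius_gt0 a0.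
have rN0 : (0 < radius alpha `^ N)%R by rewrite powR_gt0.
have -> : (N * level alpha = (N * B N) * (G * radius alpha `^ N))%R.
  by rewrite /level; ring.
have e_pow : ((radius alpha `^ N) `^ (alpha / N) = (G * B alpha)^-1)%R.
  rewrite -powRrM mulrCA mulfV ?gt_eqF// mulr1 /radius -powRrM mulVf ?gt_eqF//.
  by rewrite powRr1// invr_ge0 ltW// GB_gt0.
have inv_pow (z e : R) : (0 <= z)%R -> (z^-1 `^ e = (z `^ e)^-1)%R.
  by move=> z0; rewrite -powR_inv1// -powRrM mulN1r powRN.
have X0 : (0 < N * B N)%R by rewrite mulr_gt0.
have Y0 : (0 < G * radius alpha `^ N)%R by rewrite mulr_gt0.
rewrite inv_pow; last by rewrite ltW// mulr_gt0.
rewrite (powRM _ (ltW X0) (ltW Y0)) (powRM _ (ltW G0) (ltW rN0)) e_pow.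
rewrite powRB; last by rewrite (gt_eqF G0) implybT.
rewrite powRr1 ?(ltW G0)//.
have Na0 : (0 < (N * B N) `^ (alpha / N))%R by rewrite powR_gt0 ?mulr_gt0.
have Ga0 : (0 < G `^ (alpha / N))%R by rewrite powR_gt0.
by field; rewrite !gt_eqF.
Qed.

End positive.

Let mass := \int[mu]_x (f x)%:E * \int[mu]_x (h x)%:E.
Let const (alpha : R) : R :=
  ((N * beta N (k + 1)) `^ (alpha / N) / beta alpha (k + 1))%R.
Let lhs (alpha : R) := (const alpha)%:E * powere (mu (star_moment alpha f h)) (alpha / N).
Let mid (alpha : R) :=
  powere mass (alpha / N) * powere (fcorr 0)%:E (1 - alpha / N).

Let N0 : (0 < N)%R. Proof. by rewrite ltr0n. Qed.

Let mass_ge0 : 0 <= mass.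
Proof. by rewrite mule_ge0// integral_ge0// => x _; rewrite lee_fin. Qed.

(** If [fcorr 0 = 0] the whole correlation vanishes and the star body is a point. *)
Lemma star_degenerate (alpha : R) : (0 < alpha)%R -> fcorr 0 = 0%R ->
  lhs alpha = 0 /\ mass = 0.
Proof.
move=> a0 g00; have g0 y : fcorr y = 0%R.
  by apply/eqP; rewrite eq_le fcorr_ge0 -g00 fcorr_le0.
split; last by rewrite /mass -integral_fcorr integral0_eq// => y _; rewrite g0.
rewrite /lhs (_ : star_moment alpha f h = [set 0%R]).
  by rewrite lebesgue_rV_set0 powere_pos ?poweR0r ?mule0 ?gt_eqF ?divr_gt0
    ?divr_ge0 ?(ltW a0).
apply/seteqP; split => [xi|_ ->]; last by left.
rewrite /star_moment/= => -[//|]; rewrite radial_moment_corr.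
rewrite /ray_moment /moment integral0_eq ?lee_fin ?ler10// => t _.
by rewrite g0 mule0.
Qed.

Let const_level (alpha : R) : (0 < fcorr 0)%R -> (0 < alpha)%R ->
  forall (v : \bar R), 0 <= v ->
  (const alpha)%:E * powere ((N * (fcorr 0 * (((fcorr 0 * beta alpha (k + 1))^-1
     `^ alpha^-1) `^ N * beta N (k + 1))))^-1%:E * v) (alpha / N) =
  powere v (alpha / N) * powere (fcorr 0)%:E (1 - alpha / N).
Proof.
move=> G0 a0 v v0; have aN0 : (0 <= alpha / N)%R by rewrite divr_ge0 ?ltW.
rewrite !(powere_pos _ aN0) powere_EFin// poweRM//; last first.
  by rewrite lee_fin invr_ge0 !mulr_ge0 ?powR_ge0 ?(ltW N0) ?(ltW G0) ?ltW ?beta_gt0.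
rewrite muleA poweR_EFin -EFinM level_normalization//.
by rewrite muleC.
Qed.

Theorem star_volume_lower (alpha : R) : (0 < alpha < N)%R -> mid alpha <= lhs alpha.
Proof.
move=> /andP[a0 aN]; have aN0 : (0 <= alpha / N)%R by rewrite divr_ge0 ?ltW.
have := fcorr_ge0 0; rewrite le_eqVlt => /predU1P[/esym g0|G0].
  have [-> m0] := star_degenerate a0 g0.
  by rewrite /mid m0 powere_pos// poweR0r ?mul0e// gt_eqF// divr_gt0.
rewrite /mid -(const_level G0 a0 mass_ge0) lee_wpmul2l//.
  by rewrite lee_fin divr_ge0 ?powR_ge0 ?ltW ?beta_gt0.
rewrite !(powere_pos _ aN0); apply: gt0_ler_poweR; rewrite ?in_itv/= ?leey ?andbT//.
  rewrite mule_ge0 ?lee_fin ?invr_ge0 ?mulr_ge0 ?powR_ge0 ?(ltW N0) ?(ltW G0)//.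
  by rewrite ltW ?beta_gt0.
exact: star_volume_ge.
Qed.

Theorem star_volume_upper (alpha : R) : (N < alpha)%R -> lhs alpha <= mid alpha.
Proof.
move=> aN; have a0 := lt_trans N0 aN.
have aN0 : (0 <= alpha / N)%R by rewrite divr_ge0 ?ltW.
have := fcorr_ge0 0; rewrite le_eqVlt => /predU1P[/esym g0|G0].
  have [-> m0] := star_degenerate a0 g0.
  by rewrite mule_ge0 ?powere_ge0.
rewrite /mid -(const_level G0 a0 mass_ge0) lee_wpmul2l//.
  by rewrite lee_fin divr_ge0 ?powR_ge0 ?ltW ?beta_gt0.
rewrite !(powere_pos _ aN0); apply: gt0_ler_poweR; rewrite ?in_itv/= ?leey ?andbT//.
  rewrite mule_ge0 ?lee_fin ?invr_ge0 ?mulr_ge0 ?powR_ge0 ?(ltW N0) ?(ltW G0)//.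
  by rewrite ltW ?beta_gt0.
exact: star_volume_le.
Qed.

End correlation_even.

(** * Comparison with the mixed norms *)

Section mixed_norms.
Context {R : realType} {n : nat}.
Local Open Scope ereal_scope.
Local Notation mu := (@lebesgue_rV R n).
Local Notation V := 'rV[R]_n.
Local Notation N := (n%:R : R).
Variables (f h : V -> R) (G : R).
Hypotheses (n_gt0 : (0 < n)%N) (G0 : (0 <= G)%R).
Hypotheses (mf : measurable_fun setT f) (mh : measurable_fun setT h).
Hypotheses (f_ge0 : forall x, (0 <= f x)%R) (h_ge0 : forall x, (0 <= h x)%R).
Hypothesis fhG : \int[mu]_x (f x * h x)%:E = G%:E.

Let N0 : (0 < N)%R. Proof. by rewrite ltr0n. Qed.

Let F := \int[mu]_x (f x)%:E.
Let H := \int[mu]_x (h x)%:E.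

Let F0 : 0 <= F. Proof. by apply: integral_ge0 => x _; rewrite lee_fin. Qed.
Let H0 : 0 <= H. Proof. by apply: integral_ge0 => x _; rewrite lee_fin. Qed.

Let hfG : \int[mu]_x (h x * f x)%:E = G%:E.
Proof. by rewrite -fhG; apply: eq_integral => x _; rewrite mulrC. Qed.

Let e (alpha : R) : R := ((N + alpha) / (2 * N))%R.
Let r (alpha : R) : R := ((N - alpha) / (N + alpha))%R.

Theorem mixed_norms_le (alpha : R) : (0 < alpha < N)%R ->
  mixed_integral mu (r alpha) f h `^ e alpha *
  mixed_integral mu (r alpha) h f `^ e alpha <=
  powere (F * H) (alpha / N) * powere G%:E (1 - alpha / N).
Proof.
move=> /andP[a0 aN].
have Na0 : (0 < N + alpha)%R by rewrite addr_gt0.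
have e0 : (0 < e alpha)%R by rewrite divr_gt0 ?mulr_gt0.
have r01 : (0 < r alpha < 1)%R.
  by rewrite divr_gt0 ?subr_gt0//= ltr_pdivrMr// mul1r; lra.
have aN1 : (0 < 1 - alpha / N)%R by rewrite subr_gt0 ltr_pdivrMr// mul1r.
have M1 := mixed_integral_le mu r01 mf mh f_ge0 h_ge0.
have M2 := mixed_integral_le mu r01 mh mf h_ge0 f_ge0.
rewrite -/F fhG in M1; rewrite -/H hfG in M2.
apply: (@le_trans _ _ ((F `^ (1 - r alpha) * G%:E `^ r alpha) `^ e alpha *
    (H `^ (1 - r alpha) * G%:E `^ r alpha) `^ e alpha)).
  apply: lee_pmul; rewrite ?poweR_ge0//; apply: gt0_ler_poweR => //;
    rewrite ?in_itv/= ?leey ?andbT ?mule_ge0 ?poweR_ge0 ?mixed_integral_ge0//;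
    by rewrite ?lee_fin ?powR_ge0// ltW.
rewrite !poweRM ?mule_ge0 ?poweR_ge0// muleACA -!poweRrM -poweRM//.
rewrite !powere_pos ?(ltW aN1) ?divr_ge0 ?(ltW a0) ?(ltW N0)//.
rewrite (_ : (1 - r alpha) * e alpha = alpha / N)%R; last first.
  by rewrite /r /e; field; rewrite !gt_eqF.
rewrite lee_wpmul2l ?poweR_ge0// !poweR_EFin -EFinM lee_fin -expr2.
rewrite -powR_mulrn ?powR_ge0// -powRrM.
rewrite (_ : r alpha * e alpha * 2 = 1 - alpha / N)%R//.
by rewrite /r /e; field; rewrite !gt_eqF.
Qed.

Theorem mixed_norms_ge (alpha : R) : (N < alpha)%R ->
  (G = 0%R -> F * H = 0) ->
  powere (F * H) (alpha / N) * powere G%:E (1 - alpha / N) <=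
  mixed_integral mu (r alpha) f h `^ e alpha *
  mixed_integral mu (r alpha) h f `^ e alpha.
Proof.
move=> aN GFH; have a0 := lt_trans N0 aN.
have aN0 : (0 < alpha / N)%R by rewrite divr_gt0.
have Na0 : (0 < N + alpha)%R by rewrite addr_gt0.
have e0 : (0 < e alpha)%R by rewrite divr_gt0 ?mulr_gt0.
set M1 := mixed_integral mu (r alpha) f h; set M2 := mixed_integral mu (r alpha) h f.
have [FH0|FH_neq0] := eqVneq (F * H) 0.
  by rewrite FH0 powere_pos ?(ltW aN0)// poweR0r ?gt_eqF// mul0e mule_ge0 ?poweR_ge0.
have Gpos : (0 < G)%R.
  by rewrite lt_neqAle G0 andbT; apply/eqP => /esym/GFH/eqP; rewrite (negbTE FH_neq0).
have [F_neq0 H_neq0] : F != 0 /\ H != 0.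
  by move: FH_neq0; rewrite mule_eq0 negb_or => /andP.
pose a : R := ((N + alpha) / (2 * alpha))%R.
have a01 : (0 < a < 1)%R.
  by rewrite divr_gt0 ?mulr_gt0//= ltr_pdivrMr ?mulr_gt0// mul1r; lra.
have /andP[a_gt0 a_lt1] := a01.
have rE : (r alpha = 1 - a^-1)%R.
  by rewrite /r /a; field; rewrite !gt_eqF.
have M10 : 0 <= M1 by exact: mixed_integral_ge0.
have M20 : 0 <= M2 by exact: mixed_integral_ge0.
have le1 : M1 < +oo -> F <= M1 `^ a * G%:E `^ (1 - a).
  by move=> ?; rewrite -fhG; exact: mixed_integral_ge.
have le2 : M2 < +oo -> H <= M2 `^ a * G%:E `^ (1 - a).
  by move=> ?; rewrite -hfG; exact: mixed_integral_ge.
have pos1 : 0 < M1.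
  rewrite lt_neqAle M10 andbT eq_sym; apply/eqP => M1E.
  have := le1; rewrite M1E ltry poweR0r ?gt_eqF// mul0e => /(_ isT) F_le0.
  by move/eqP: F_neq0; apply; apply/eqP; rewrite eq_le F_le0 F0.
have pos2 : 0 < M2.
  rewrite lt_neqAle M20 andbT eq_sym; apply/eqP => M2E.
  have := le2; rewrite M2E ltry poweR0r ?gt_eqF// mul0e => /(_ isT) H_le0.
  by move/eqP: H_neq0; apply; apply/eqP; rewrite eq_le H_le0 H0.
have [M1oo|M1fin] := eqVneq M1 +oo.
  by rewrite M1oo (poweRyr (lt0r_neq0 e0)) (gt0_mulye (poweR_gt0 _ pos2)) leey.
have [M2oo|M2fin] := eqVneq M2 +oo.
  by rewrite M2oo (poweRyr (lt0r_neq0 e0)) (gt0_muley (poweR_gt0 _ pos1)) leey.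
have {}le1 : F <= M1 `^ a * G%:E `^ (1 - a) by apply: le1; rewrite lt_neqAle M1fin leey.
have {}le2 : H <= M2 `^ a * G%:E `^ (1 - a) by apply: le2; rewrite lt_neqAle M2fin leey.
rewrite powere_pos ?(ltW aN0)// powere_EFin//.
apply: (@le_trans _ _ ((M1 `^ a * G%:E `^ (1 - a) * (M2 `^ a * G%:E `^ (1 - a)))
    `^ (alpha / N) * (G `^ (1 - alpha / N))%:E)).
  rewrite lee_wpmul2r ?lee_fin ?powR_ge0//; apply: gt0_ler_poweR.
  - exact: ltW.
  - by rewrite in_itv/= leey andbT mule_ge0.
  - by rewrite in_itv/= leey andbT !mule_ge0 ?poweR_ge0 ?lee_fin ?powR_ge0.
  - exact: (lee_pmul F0 H0 le1 le2).
rewrite muleACA -(poweRM a M10 M20) -(poweRM (e alpha) M10 M20).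
rewrite [X in X * _ <= _]poweRM ?poweR_ge0//; last first.
  by rewrite mule_ge0 ?lee_fin ?powR_ge0.
rewrite -poweRrM (_ : a * (alpha / N) = e alpha)%R; last first.
  by rewrite /a /e; field; rewrite !gt_eqF.
have -> : (G%:E `^ (1 - a) * G%:E `^ (1 - a)) `^ (alpha / N) =
    (G `^ ((1 - a) * (2 * (alpha / N))))%:E.
  by rewrite poweR_EFin -EFinM poweR_EFin -expr2 -powR_mulrn ?powR_ge0// -!powRrM.
rewrite -muleA -EFinM -powRD; last by rewrite (gt_eqF Gpos) implybT.
rewrite (_ : _ + _ = 0)%R ?powRr0 ?mule1//.
by rewrite /a; field; rewrite !gt_eqF.
Qed.

End mixed_norms.

Unset Implicit Arguments.

Theorem corollary1 (R : realType) (n : nat) (s : R) (f h : 'rV[R]_n -> R)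
    (n_gt0 : (0 < n)%N) (s_gt0 : 0 < s)
    (f_ge0 : forall x, 0 <= f x) (h_ge0 : forall x, 0 <= h x)
    (f_L2 : square_integrable f) (h_L2 : square_integrable h)
    (f_even : even_fun f) (h_even : even_fun h)
    (f_conc : s_concave_on_support s f) (h_conc : s_concave_on_support s h) :
  let N : R := n%:R in
  let mu := lebesgue_rV n in
  let c (alpha : R) :=
    (N * beta N (N + 1 + 2 / s)) `^ (alpha / N) /
    beta alpha (N + 1 + 2 / s) in
  let lhs (alpha : R) : \bar R :=
    ((c alpha)%:E * powere (mu (star_moment alpha f h)) (alpha / N))%E in
  let mid (alpha : R) : \bar R :=
    (powere ('N[mu]_1[EFin \o f] * 'N[mu]_1[EFin \o h]) (alpha / N) *
     powere (\int[mu]_x (f x * h x)%:E) (1 - alpha / N))%E in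
  let mix (alpha : R) (u v : 'rV[R]_n -> R) (x : 'rV[R]_n) : \bar R :=
    (powere (u x)%:E ((N + alpha) / (2 * N)) *
     powere (v x)%:E ((N - alpha) / (2 * N)))%E in
  let rhs (alpha : R) : \bar R :=
    ('N[mu]_(2 * N / (N + alpha))%:E[mix alpha f h] *
     'N[mu]_(2 * N / (N + alpha))%:E[mix alpha h f])%E in
  (forall alpha : R, 0 < alpha < N ->
     (rhs alpha <= mid alpha <= lhs alpha)%E) /\
  (forall alpha : R, N < alpha ->
     (lhs alpha <= mid alpha <= rhs alpha)%E).
Proof.
move=> N mu c lhs mid mix rhs.
have N_gt0 : 0 < N by rewrite ltr0n.
have fM x : 0 <= f x <= f 0 by rewrite f_ge0 (even_s_concave_le0 _ s_gt0).
have hM x : 0 <= h x <= h 0 by rewrite h_ge0 (even_s_concave_le0 _ s_gt0).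
have [f1 [f2 [mf1 _ fB f12 _]]] := square_integrable_squeeze fM f_L2.
have [h1 [h2 [mh1 _ hB h12 _]]] := square_integrable_squeeze hM h_L2.
have f1_ge0 x : 0 <= f1 x by have [] := fB x.
have h1_ge0 x : 0 <= h1 x by have [] := hB x.
have ff1 : {ae mu, forall x, f x = f1 x}.
  apply: filterS f12 => x e; have [_ [u1u uu2]] := fB x.
  by apply/eqP; rewrite eq_le u1u e uu2.
have hh1 : {ae mu, forall x, h x = h1 x}.
  apply: filterS h12 => x e; have [_ [u1u uu2]] := hB x.
  by apply/eqP; rewrite eq_le u1u e uu2.
pose g := fcorr f h.
have norm1 (u : 'rV[R]_n -> R) : (forall x, 0 <= u x) ->
    ('N[mu]_1[EFin \o u] = \int[mu]_x (u x)%:E)%E.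
  by move=> u0; rewrite Lnorm1; apply: eq_integral => x _; rewrite /= ger0_norm.
have int1 (u u1 : 'rV[R]_n -> R) : (forall x, 0 <= u x) -> (forall x, 0 <= u1 x) ->
    {ae mu, forall x, u x = u1 x} ->
    (\int[mu]_x (u x)%:E = \int[mu]_x (u1 x)%:E)%E.
  move=> u0 u10 uu1; apply: ae_eq_integral_gen.
  - by move=> x; rewrite lee_fin.
  - by move=> x; rewrite lee_fin.
  - by apply: filterS uu1 => x ->.
have fcorr0E : ((g 0)%:E = \int[mu]_x (f x * h x)%:E)%E.
  rewrite (fcorrE s_gt0 f_ge0 h_ge0 f_L2 h_L2 f_even h_even f_conc h_conc).
  by apply: eq_integral => x _; rewrite addr0 mulrC.
have midE alpha : mid alpha =
    (powere (\int[mu]_x (f x)%:E * \int[mu]_x (h x)%:E) (alpha / N) *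
     powere (g 0)%:E (1 - alpha / N))%E.
  by rewrite /mid fcorr0E !norm1.
have fh1 : (\int[mu]_x (f1 x * h1 x)%:E = (g 0)%:E)%E.
  rewrite fcorr0E; apply: ae_eq_integral_gen.
  - by move=> x; rewrite lee_fin mulr_ge0.
  - by move=> x; rewrite lee_fin mulr_ge0.
  - by apply: filterS2 ff1 hh1 => x -> ->.
have g00 : 0 <= g 0 by exact: fcorr_ge0.
have lhsE alpha : lhs alpha =
    (((N * beta N ((N + 2 / s) + 1)) `^ (alpha / N) /
      beta alpha ((N + 2 / s) + 1))%:E *
     powere (mu (star_moment alpha f h)) (alpha / N))%E.
  by rewrite /lhs /c -!(addrA N) (addrC 1).
have mixedE (r : R) (u v u1 v1 : 'rV[R]_n -> R) : (forall x, 0 <= u x) ->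
    (forall x, 0 <= u1 x) -> {ae mu, forall x, u x = u1 x} ->
    {ae mu, forall x, v x = v1 x} ->
    mixed_integral mu r u v = mixed_integral mu r u1 v1.
  move=> u0 u10 uu1 vv1; apply: ae_eq_integral_gen.
  - by move=> x; rewrite mule_ge0 ?lee_fin ?powere_ge0.
  - by move=> x; rewrite mule_ge0 ?lee_fin ?powere_ge0.
  - by apply: filterS2 uu1 vv1 => x -> ->.
have rhsE alpha : 0 < alpha -> rhs alpha =
    (mixed_integral mu ((N - alpha) / (N + alpha)) f1 h1 `^ ((N + alpha) / (2 * N)) *
     mixed_integral mu ((N - alpha) / (N + alpha)) h1 f1 `^ ((N + alpha) / (2 * N)))%E.
  move=> a0; have Na0 : 0 < N + alpha by rewrite addr_gt0.
  have p0 : 0 < 2 * N / (N + alpha) by rewrite divr_gt0 ?mulr_gt0.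
  have normE (u v u1 v1 : 'rV[R]_n -> R) : (forall x, 0 <= u x) ->
      (forall x, 0 <= v x) -> (forall x, 0 <= u1 x) ->
      {ae mu, forall x, u x = u1 x} -> {ae mu, forall x, v x = v1 x} ->
      ('N[mu]_(2 * N / (N + alpha))%:E[mix alpha u v] =
       mixed_integral mu ((N - alpha) / (N + alpha)) u1 v1
         `^ ((N + alpha) / (2 * N)))%E.
    move=> u0 v0 u10 uu1 vv1.
    have pV : (2 * N / (N + alpha))^-1 = (N + alpha) / (2 * N) by rewrite invf_div.
    rewrite -(mixedE _ _ _ _ _ u0 u10 uu1 vv1) /mix -pV.
    have rE : (N - alpha) / (2 * N) * (2 * N / (N + alpha)) =
        (N - alpha) / (N + alpha) by field; rewrite !gt_eqF.
    by rewrite -rE; exact: Lnorm_mixed.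
  by rewrite /rhs (normE _ _ f1 h1)// (normE _ _ h1 f1).
split=> alpha; rewrite midE lhsE.
  move=> a0N; have /andP[a0 aN] := a0N; rewrite rhsE//; apply/andP; split.
    rewrite (int1 f f1)// (int1 h h1)//.
    exact: (mixed_norms_le n_gt0 mf1 mh1 f1_ge0 h1_ge0 fh1).
  exact: star_volume_lower.
move=> aN; rewrite rhsE ?(lt_trans N_gt0 aN)//; apply/andP; split.
  exact: star_volume_upper.
rewrite (int1 f f1)// (int1 h h1)//.
apply: (mixed_norms_ge n_gt0 g00 mf1 mh1 f1_ge0 h1_ge0 fh1) => // g0.
rewrite -(int1 f f1)// -(int1 h h1)//.
have [] := star_degenerate n_gt0 s_gt0 f_ge0 h_ge0 f_L2 h_L2 f_even h_even f_conc
  h_conc (lt_trans N_gt0 aN) g0.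
by [].
Qed.
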